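(* Let $k\geq 3$ be an integer. For all sufficiently large $n\in\mathbb{N}$ (depending on $k$), $$M_{C_k}(n) = \begin{cases} \left\lceil \log_{k-1} (n+k^2-4k+2)\right\rceil & \text{if } k \text{ is odd},\\ \left\lceil \log_{k-1}(2n+k^2-5k)\right\rceil & \text{if } k \text{ is even}.\end{cases}$$
   Context: All graphs are finite and simple. $C_k$ is the cycle on $k$ vertices. For graphs $H$, $G$, let $n_H(G)$ be the number of copies of $H$ in $G$ (not necessarily induced subgraphs isomorphic to $H$). The $H$-bootstrap process (or $H$-process) on $G$ is the sequence $(G_i)_{i\ge 0}$ with $G_0=G$, $V(G_i)=V(G)$ and, for $i\ge 1$, $E(G_i)=E(G_{i-1})\cup\{e\in\binom{V(G)}{2}: n_H(G_{i-1}+e)>n_H(G_{i-1})\}$. The running time is $\tau_H(G)=\min\{t\ge 0: G_t=G_{t+1}\}$, and $M_H(n)=\max\{\tau_H(G): |V(G)|=n\}$. *)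

(* Defs.v *)
From mathcomp Require Import all_boot.

Set Implicit Arguments.
Unset Strict Implicit.
Unset Printing Implicit Defensive.

(* A graph with vertex set T is given by its edge set, of type {set {set T}};
   isolated vertices are therefore part of the graph. *)

Definition pairs (T : finType) : {set {set T}} := [set e : {set T} | #|e| == 2].

Definition simple_graph (T : finType) (G : {set {set T}}) : bool :=
  G \subset pairs T.

Definition cycle_graph (k : nat) : {set {set 'I_k}} :=
  [set [set i; ordS i] | i : 'I_k].

(* A copy of H in G is a subgraph (vertex set, edge set) of G isomorphic to H;
   copies are counted as subgraphs, not as embeddings. *)
Definition is_copy (U T : finType) (H : {set {set U}}) (G : {set {set T}})
    (S : {set T} * {set {set T}}) : bool :=
  (S.2 \subset G) &&
  [exists f : {ffun U -> T},
     [&& injectiveb f, S.1 == [set f u | u : U] & S.2 == [set f @: (e : {set U}) | e in H]]].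

Definition ncopies (U T : finType) (H : {set {set U}}) (G : {set {set T}}) : nat :=
  #|[set S | is_copy H G S]|.

Definition bootstrap_step (U T : finType) (H : {set {set U}})
    (G : {set {set T}}) : {set {set T}} :=
  G :|: [set e in pairs T | ncopies H G < ncopies H (e |: G)].

Definition bootstrap (U T : finType) (H : {set {set U}}) (G : {set {set T}})
    (i : nat) : {set {set T}} :=
  iter i (bootstrap_step H) G.

Lemma bootstrap_stabilises (U T : finType) (H : {set {set U}})
    (G : {set {set T}}) :
  exists t, bootstrap H G t == bootstrap H G t.+1.
Proof.
pose N := #|{set T}|.+1.
case: (boolP [exists t : 'I_N, bootstrap H G t == bootstrap H G t.+1]).
  by case/existsP=> t eq_t; exists t.
rewrite negb_exists => /forallP neq.
have grow t : t <= N -> t <= #|bootstrap H G t|.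
  elim: t => // t IHt lt_tN; apply: leq_ltn_trans (IHt (ltnW lt_tN)) _.
  by apply: proper_card; rewrite properEneq (neq (Ordinal lt_tN)) subsetUl.
by have := leq_trans (grow N (leqnn N)) (max_card _); rewrite ltnn.
Qed.

Definition running_time (U T : finType) (H : {set {set U}})
    (G : {set {set T}}) : nat :=
  ex_minn (bootstrap_stabilises H G).

(* Running times are invariant under isomorphism, so it suffices to consider
   the vertex set 'I_n. *)
Definition max_running_time (U : finType) (H : {set {set U}}) (n : nat) : nat :=
  \max_(G : {set {set 'I_n}} | simple_graph G) running_time H G.

(* Main.v *)
Require Import Defs.
From mathcomp Require Import all_boot zify.

(* Put K = k - 1. A missing edge is added in a step iff its ends are joined by a
   path with K edges. Composing steps along a long path, t steps join exactly
   the vertices at distance K ^ t - s with s in the numerical semigroup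
   generated by K - 1 (a jump by K is replaced by a jump by 1) and K + 1 (it is
   replaced by a jump by -1), as long as the distance is not bounded. Bounded
   distances are dealt with in bounded time, because a saturated connected graph
   with more than k vertices and a path on k vertices is complete or complete
   bipartite.
   For odd k the extremal graph is a path, and the Frobenius number
   K ^ 2 - 2 * K - 1 of the semigroup gives the formula.
   For even k all walks involved are odd. In a shortest odd walk the coincidences
   are concentric, so it runs down a tail, around an odd cycle and back, and its
   length is at most 2 * n - 5. The extremal graph is a path with a triangle at
   one end and a twin of the vertex at the other end; the walk between the twins
   has to land on the triangle after one step, and its halves have lengths that
   differ by one, which excludes the balanced representations
   s = a * (K - 1) + b * (K + 1) with a + b even and small. Conversely, the
   positions of the walk congruent modulo K to one of its two middle positions
   are pairwise distinct vertices, hence form a path of the first-step graph. *)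

Set Implicit Arguments.
Unset Strict Implicit.
Unset Printing Implicit Defensive.

(** * Walks and one step of the process *)

(* Walks and paths are functions on nat of which only the values up to g
   matter. *)
Definition walk (T : Type) (R : rel T) (g : nat) (w : nat -> T) : Prop :=
  forall i, i < g -> R (w i) (w i.+1).

Definition inj_upto (T : Type) (g : nat) (w : nat -> T) : Prop :=
  forall i j, i <= g -> j <= g -> w i = w j -> i = j.

Definition adj (T : finType) (G : {set {set T}}) : rel T :=
  fun x y => [set x; y] \in G.

Lemma walk_rev (T : Type) (R : rel T) (g : nat) (w : nat -> T) :
  symmetric R -> walk R g w -> walk R g (fun i => w (g - i)).
Proof.
move=> symR wR i ltig; rewrite symR.
have -> : g - i = (g - i.+1).+1 by lia.
by apply: wR; lia.
Qed.

Lemma inj_upto_rev (T : Type) (g : nat) (w : nat -> T) :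
  inj_upto g w -> inj_upto g (fun i => w (g - i)).
Proof. by move=> wI i j leig lejg /wI; lia. Qed.

Definition reach (T : Type) (R : rel T) (g : nat) (x y : T) : Prop :=
  exists v, [/\ walk R g v, v 0 = x & v g = y].

Lemma reach_cat (T : Type) (R : rel T) g h x y z :
  reach R g x y -> reach R h y z -> reach R (g + h) x z.
Proof.
case=> v [vR v0 vg] [u [uR u0 uh]].
exists (fun i => if i <= g then v i else u (i - g)); split=> //; last first.
  case: leqP => h1; last by rewrite addKn.
  have Eh : h = 0 by lia.
  by rewrite Eh addn0 vg -u0 -uh Eh.
move=> i lti; case: (ltngtP i g) => [hi|hi|hi].
- exact: vR.
- by rewrite subSn ?(ltnW hi) //; apply: uR; lia.
- by rewrite hi vg -u0 subSnn; apply: uR; lia.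
Qed.

Lemma reach_rev (T : Type) (R : rel T) g x y :
  symmetric R -> reach R g x y -> reach R g y x.
Proof.
move=> symR [v [vR <- <-]]; exists (fun i => v (g - i)).
by rewrite subn0 subnn; split=> //; apply: walk_rev.
Qed.

Lemma reach_sub (T : Type) (R : rel T) g v a b :
  walk R g v -> a <= b <= g -> reach R (b - a) (v a) (v b).
Proof.
move=> vR /andP[leab lebg]; exists (fun i => v (a + i)).
by rewrite addn0 subnKC //; split=> // i lti; rewrite addnS; apply: vR; lia.
Qed.

Lemma reach_short (T : Type) (R : rel T) g v i j :
  walk R g v -> i < j <= g -> v i = v j -> reach R (g - (j - i)) (v 0) (v g).
Proof.
move=> vR /andP[ltij lejg] E.
have -> : g - (j - i) = i - 0 + (g - j) by lia.
apply: reach_cat (reach_sub vR (_ : 0 <= i <= g)) _; first by lia.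
by rewrite E; apply: reach_sub vR _; rewrite lejg leqnn.
Qed.

Lemma inj_uptoPn (T : eqType) g (v : nat -> T) :
  inj_upto g v \/ exists i j, i < j <= g /\ v i = v j.
Proof.
case: (boolP [exists i : 'I_g.+1, exists j : 'I_g.+1, (i < j) && (v i == v j)]).
  case/existsP=> i /existsP[j /andP[ltij /eqP E]]; right.
  by exists i, j; rewrite ltij -ltnS ltn_ord.
rewrite negb_exists => /forallP h; left.
have main i j : i < j -> j <= g -> v i <> v j.
  move=> ltij lej E; have lti : i < g.+1 by lia.
  have := h (Ordinal lti); rewrite negb_exists => /forallP/(_ (Ordinal (lej : j < g.+1))).
  by rewrite /= ltij E eqxx.
move=> i j lei lej E; case: (ltngtP i j) => // hij.
  by case: (main i j hij lej).
by case: (main j i hij lei).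
Qed.

Lemma inj_upto_card (T : finType) g (v : nat -> T) : inj_upto g v -> g < #|T|.
Proof.
move=> vI; pose f (i : 'I_g.+1) := v i.
have injf : injective f.
  by move=> i j /vI E; apply: val_inj; apply: E; rewrite -ltnS ltn_ord.
by have := leq_card f injf; rewrite card_ord.
Qed.

(** * One step of the process in terms of paths *)

Section Step.

Variables (T : finType) (K : nat).
Hypothesis K_gt1 : 1 < K.

Let C := cycle_graph K.+1.

Lemma adj_sym (G : {set {set T}}) : symmetric (adj G).
Proof. by move=> x y; rewrite /adj setUC. Qed.

Lemma adj_neq (G : {set {set T}}) x y : simple_graph G -> adj G x y -> x != y.
Proof.
by move=> /subsetP sG /sG; rewrite inE cards2; case: (x != y).
Qed.

Lemma set2_eq (U : finType) (a b c d : U) :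
  [set a; b] = [set c; d] -> (a = c /\ b = d) \/ (a = d /\ b = c).
Proof.
move=> E.
have hb : b \in [set c; d] by rewrite -E set22.
have hc : c \in [set a; b] by rewrite E set21.
have hd : d \in [set a; b] by rewrite E set22.
have: a \in [set c; d] by rewrite -E set21.
rewrite inE !in_set1 => /orP[] /eqP ea; subst a.
  left; split=> //; move: hb hd; rewrite !inE.
  by case/orP => /eqP ->; rewrite // orbb => /eqP ->.
right; split=> //; move: hb hc; rewrite !inE.
by case/orP => /eqP ->; rewrite // orbb => /eqP ->.
Qed.

Lemma simple_step (G : {set {set T}}) :
  simple_graph G -> simple_graph (bootstrap_step C G).
Proof.
move=> sG; rewrite /simple_graph subUset; apply/andP; split=> //.
by apply/subsetP=> e; rewrite inE => /andP[].
Qed.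

Lemma is_copyS (G H : {set {set T}}) S :
  G \subset H -> is_copy C G S -> is_copy C H S.
Proof.
by move=> sGH /andP[sS hS]; rewrite /is_copy (subset_trans sS sGH).
Qed.

(** Adding an edge destroys no copy, so the count grows iff some copy of the cycle uses the new
    edge. Without that edge the copy is a path with [K] edges. *)
Lemma adj_step (G : {set {set T}}) x y : simple_graph G ->
  adj (bootstrap_step C G) x y <->
  adj G x y \/ exists w, [/\ w 0 = x, w K = y, inj_upto K w & walk (adj G) K w].
Proof.
move=> sG; rewrite {1}/adj /bootstrap_step inE; split.
  case/orP => [|]; first by left.
  rewrite inE => /andP[_]; set e := [set x; y] => lt_nc; right.
  have [S copyS NcopyS] : exists2 S, is_copy C (e |: G) S & ~~ is_copy C G S.
    case: (boolP [exists S, is_copy C (e |: G) S && ~~ is_copy C G S]).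
      by case/existsP=> S /andP[]; exists S.
    rewrite negb_exists => /forallP hS.
    suff : ncopies C (e |: G) <= ncopies C G by rewrite leqNgt lt_nc.
    apply: subset_leq_card; apply/subsetP=> S; rewrite !inE => cS.
    by have := hS S; rewrite cS negbK.
  case/andP: copyS => sSeG /existsP[f /and3P[/injectiveP injf S1 /eqP S2]].
  have : ~~ (S.2 \subset G).
    apply: contra NcopyS => sSG; rewrite /is_copy sSG.
    by apply/existsP; exists f; rewrite S1 S2 eqxx; apply/andP; split=> //; apply/injectiveP.
  case/subsetPn => e' e'S e'G.
  have ee' : e' = e.
    by have := subsetP sSeG _ e'S; rewrite !inE (negbTE e'G) orbF => /eqP.
  have edgef (i : 'I_K.+1) : f @: [set i; ordS i] = [set f i; f (ordS i)].
    by rewrite imsetU !imset_set1.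
  have edgeS (i : 'I_K.+1) : [set f i; f (ordS i)] \in S.2.
    by rewrite S2 -edgef; apply: imset_f; apply/imsetP; exists i.
  have [i ei] : exists i, e = [set f i; f (ordS i)].
    move: e'S; rewrite S2 ee' => /imsetP[c /imsetP[i _ ->] ->].
    by exists i; rewrite edgef.
  (* The cycle is read from one end of the new edge round to the other, so that the new edge joins
     positions [K] and 0. *)
  pose v j := f (inord ((i + 1 + j) %% K.+1)).
  have valv j : (inord ((i + 1 + j) %% K.+1) : 'I_K.+1) = (i + 1 + j) %% K.+1 :> nat.
    by rewrite inordK // ltn_mod.
  have v0 : v 0 = f (ordS i).
    by congr (f _); apply: val_inj; rewrite /= valv addn0 addn1.
  have vK : v K = f i.
    congr (f _); apply: val_inj; rewrite /= valv.
    by rewrite -addnA add1n modnDr modn_small.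
  have vI : inj_upto K v.
    move=> a b leaK lebK /injf/(congr1 val); rewrite /= !valv => /eqP.
    rewrite eqn_modDl => /eqP; rewrite !modn_small //; lia.
  have vW : walk (adj G) K v.
    move=> a ltaK; rewrite /adj.
    pose c : 'I_K.+1 := inord ((i + 1 + a) %% K.+1).
    have vS : v a.+1 = f (ordS c).
      congr (f _); apply: val_inj; rewrite /= !valv.
      by rewrite -[in RHS]addn1 modnDml addnS [in RHS]addn1.
    have := subsetP sSeG _ (edgeS c).
    rewrite -vS inE => /orP[|//]; rewrite inE => /eqP E; exfalso.
    (* The new edge joins positions 0 and [K], which are not consecutive because [K > 1]. *)
    move: E; rewrite ei -v0 -vK.
    case/set2_eq => -[/vI h1 /vI h2].
      by have := h1 (ltnW ltaK) (leqnn _); lia.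
    by have := h1 (ltnW ltaK) (leq0n _); have := h2 ltaK (leqnn _); lia.
  move: ei; rewrite /e -v0 -vK => /set2_eq[[-> ->]|[-> ->]].
    exists (fun j => v (K - j)); rewrite subn0 subnn; split=> //.
      exact: inj_upto_rev.
    by apply: walk_rev => //; apply: adj_sym.
  by exists v.
case=> [|[w [w0 wK wI wW]]]; first by rewrite /adj => ->.
case: (boolP ([set x; y] \in G)) => //= NeG.
have nxy : x != y by rewrite -w0 -wK; apply/eqP=> /wI; lia.
rewrite inE; apply/andP; split; first by rewrite inE cards2 nxy.
apply: proper_card; apply/properP; split.
  apply/subsetP=> S; rewrite !inE; apply: is_copyS; exact: subsetUr.
pose f : {ffun 'I_K.+1 -> T} := [ffun u => w (val u)].
have injf : injective f.
  move=> a b; rewrite !ffunE => /wI h; apply: val_inj; apply: h; by rewrite -ltnS ltn_ord.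
exists ([set f u | u : 'I_K.+1], [set f @: (e : {set 'I_K.+1}) | e in C]).
  rewrite inE /is_copy /=; apply/andP; split.
    apply/subsetP=> _ /imsetP[_ /imsetP[i _ ->] ->].
    rewrite imsetU !imset_set1 !ffunE /= !inE.
    case: (ltnP i K) => [ltiK|leKi].
      by rewrite modn_small // [X in _ || X]wW // orbT.
    have -> : val i = K by have := ltn_ord i; rewrite /=; lia.
    by rewrite modnn w0 wK setUC eqxx.
  by apply/existsP; exists f; rewrite !eqxx !andbT; apply/injectiveP.
rewrite inE /is_copy /= negb_and; apply/orP; left.
apply/subsetPn; exists [set x; y] => //.
apply/imsetP; exists [set ord_max; ordS ord_max].
  by apply/imsetP; exists ord_max.
by rewrite imsetU !imset_set1 !ffunE /= modnn w0 wK setUC.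
Qed.

End Step.

(** * Saturated graphs *)

Section Saturated.

Variables (T : eqType) (R : rel T) (K : nat).
Hypothesis K_gt1 : 1 < K.
Hypothesis symR : symmetric R.
Hypothesis irrR : irreflexive R.
Hypothesis closedR :
  forall w, walk R K w -> inj_upto K w -> R (w 0) (w K).

(** A cycle on [K + 1] vertices as a periodic sequence, so that going round needs no reduction of
    indices. *)
Definition cyc (c : nat -> T) : Prop :=
  (forall i, R (c i) (c i.+1)) /\ (forall i j, c i = c j <-> i = j %[mod K.+1]).

Definition off (c : nat -> T) (z : T) : Prop := forall i, z <> c i.

Lemma cycD c i n : cyc c -> c (i + n * K.+1) = c i.
Proof. by case=> _ cE; apply/cE; rewrite addnC modnMDl. Qed.

Lemma cyc_inj c a i j : cyc c -> i <= K -> j <= K -> c (a + i) = c (a + j) -> i = j.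
Proof.
move=> [_ cE] leiK lejK /cE/eqP; rewrite eqn_modDl => /eqP.
by rewrite !modn_small.
Qed.

Lemma cycSE c i j : cyc c -> c i.+1 = c j.+1 <-> c i = c j.
Proof.
move=> [_ cE]; rewrite !cE -[i.+1]addn1 -[j.+1]addn1.
by split=> /eqP E; apply/eqP; move: E; rewrite eqn_modDr.
Qed.

Lemma offPn c z : cyc c -> off c z \/ exists i, z = c i.
Proof.
move=> cc; case: (boolP (z \in [seq c i | i <- iota 0 K.+1])) => [|nz].
  by case/mapP=> i _ ->; right; exists i.
left=> i zi; case/negP: nz; apply/mapP; exists (i %% K.+1).
  by rewrite mem_iota ltn_mod.
by rewrite zi; case: cc => _ cE; apply/cE; rewrite modn_mod.
Qed.

(* The path z, c_i, c_(i+1), .., c_(i+K-1). *)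
Lemma off_shift c z i : cyc c -> off c z -> R z (c i) -> R z (c (i + (K - 1))).
Proof.
move=> cc oz zi; pose w j := if j is j'.+1 then c (i + j') else z.
have -> : c (i + (K - 1)) = w K by rewrite /w; case: K K_gt1 => // K' _; rewrite subSS subn0.
apply: (@closedR w) => [[|j] ltjK|[|a] [|b] lea leb //=].
- by rewrite /= addn0.
- by rewrite /= addnS; case: cc.
- by move/oz.
- by move/esym/oz.
- by move/(cyc_inj cc) => ->; lia.
Qed.

(** Modulo [K + 1], the product of [K] and [K - 1] is 2, so [K] shifts by [K - 1] amount to a shift
    by 2. *)
Lemma off_add2 c z i : cyc c -> off c z -> R z (c i) -> R z (c (i + 2)).
Proof.
move=> cc oz zi.
have H n : R z (c (i + n * (K - 1))).
  by elim: n => [|n IHn]; rewrite ?addn0 // mulSn addnCA addnC; apply: off_shift.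
have := H K; congr (R z _).
have -> : i + K * (K - 1) = i + 2 + (K - 2) * K.+1 by nia.
exact: cycD.
Qed.

Lemma off_parity c z i j : cyc c -> off c z -> R z (c i) -> odd i = odd j -> R z (c j).
Proof.
move=> cc oz zi eqij.
have H n : R z (c (i + n.*2)).
  by elim: n => [|n IHn]; rewrite ?addn0 // doubleS -addn2 addnA; apply: off_add2.
(* An even number of turns moves [j] past [i] without changing its parity. *)
rewrite -(cycD j (i.*2) cc); set m := j + _.
have leim : i <= m by rewrite /m; nia.
have om : ~~ odd (m - i).
  by rewrite oddB // /m oddD oddM odd_double addbF eqij addbb.
by have := H (m - i)./2; rewrite even_halfK // subnKC.
Qed.

Definition swap (c : nat -> T) m z j := if j == m %[mod K.+1] then z else c j.

Lemma swapE c m z : swap c m z m = z.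
Proof. by rewrite /swap eqxx. Qed.

Lemma swapN c m z j : cyc c -> c j <> c m -> swap c m z j = c j.
Proof.
case=> _ cE ne; rewrite /swap; case: eqP => // /cE E; by case: ne.
Qed.

(** [z] is adjacent to the other neighbour [c (m + K)] of [c m] too, because [m + K] is [m.+1]
    shifted by [K - 1]. *)
Lemma cyc_swap c m z : cyc c -> off c z -> R z (c m.+1) -> cyc (swap c m z).
Proof.
move=> cc oz zm; have [cR cE] := cc.
have zm' : R z (c (m + K)).
  by have := off_shift cc oz zm; rewrite addSn -addnS -subSn ?subn1 //; lia.
split=> [i|i j]; rewrite /swap.
  case: eqP => [/cE im|nim]; case: eqP => [/cE iSm|niSm].
  - have E : c i = c i.+1 by rewrite im iSm.
    by have := cR i; rewrite -E irrR.
  - by have /(cycSE _ _ cc) -> := im.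
  - rewrite symR; have -> // : c i = c (m + K).
    by apply/(cycSE i _ cc); rewrite iSm -addnS -[K.+1]mul1n cycD.
  - exact: cR.
case: eqP => [im|nim]; case: eqP => [jm|njm].
- by split=> // _; rewrite im jm.
- by split=> [/oz//|E]; case: njm; rewrite -E im.
- by split=> [/esym/oz//|E]; case: nim; rewrite E jm.
- exact: cE.
Qed.

Lemma off_swap c m z : cyc c -> off c z -> off (swap c m z) (c m).
Proof.
move=> [_ cE] oz i; rewrite /swap; case: eqP => [_ /esym/oz //|ne /cE E]; exact: ne.
Qed.

(* The path c_(a+1), .., c_b, c_a, c_(a-1), .., c_(b+1) uses the chord once and
   visits all vertices of the cycle. *)
Lemma chord_shift c a b : cyc c -> R (c a) (c b) -> R (c a.+1) (c b.+1).
Proof.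
move=> cc; have [cR cE] := cc.
have [d [led Eb]] : exists d, d <= K /\ c b = c (a + d).
  (* [K] acts as -1, so this is the residue of [b - a]. *)
  exists ((b + a * K) %% K.+1); split; first by rewrite -ltnS ltn_mod.
  by apply/cE; rewrite modnDmr addnCA -mulnS addnC modnMDl.
rewrite Eb => Rad; have /(cycSE _ _ cc) -> := Eb.
have d_gt0 : 0 < d by case: d Rad {led Eb} => //; rewrite addn0 irrR.
pose w i := if i < d then c (a + i.+1) else c (a + (K.+1 - (i - d))).
have -> : c a.+1 = w 0 by rewrite /w d_gt0 addn1.
have -> : c (a + d).+1 = w K.
  by rewrite /w ltnNge led /= -addnS; congr (c (a + _)); lia.
apply: closedR => [i ltiK|i j leiK lejK]; rewrite /w.
  case: (ltnP i.+1 d) => [ltSid|led'].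
    by rewrite ltnW // [a + i.+2]addnS; apply: cR.
  case: (ltnP i d) => [ltid|led''].
    have -> : i.+1 = d by lia.
    rewrite subnn subn0 symR; suff -> : c (a + K.+1) = c a by [].
    by rewrite -[K.+1]mul1n cycD.
  rewrite symR; have -> : K.+1 - (i - d) = (K.+1 - (i.+1 - d)).+1 by lia.
  by rewrite addnS; apply: cR.
have win u v : 0 < u <= K.+1 -> 0 < v <= K.+1 -> c (a + u) = c (a + v) -> u = v.
  case: u v => [|u] [|v] // /andP[_ leu] /andP[_ lev].
  by rewrite -!addSnnS => /(cyc_inj cc) -> //.
case: (ltnP i d) => hi; case: (ltnP j d) => hj /win; lia.
Qed.

Lemma cyc_neSS c i : cyc c -> c i.+2 <> c i.
Proof.
move=> cc; rewrite -[in c i.+2]addn2 -[in X in _ <> X](addn0 i).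
by move/(cyc_inj cc); lia.
Qed.

(** * Complete saturated components *)

Definition complete_on (c : nat -> T) : Prop :=
  forall i j, c i <> c j -> R (c i) (c j).

(* The cycle c' shares a vertex with c, so both lie in the same component. *)
Definition collapsing (c : nat -> T) : Prop :=
  exists c' v a m, [/\ cyc c', off c' v, R v (c' a), R v (c' a.+1) & c' m = c m].

Lemma off_all c v a : cyc c -> off c v -> R v (c a) -> R v (c a.+1) ->
  forall j, R v (c j).
Proof.
move=> cc ov va vSa j; case: (odd j =P odd a) => [E|NE].
  exact: (off_parity cc ov va).
by apply: (off_parity cc ov vSa) => /=; case: (odd j) (odd a) NE => [] [].
Qed.

(** Consecutive indices have both parities, so [v] is adjacent to the whole cycle. Put in the place
    of [c i], it frees [c i], which has the consecutive neighbours [v] and [c i.+1] on the new cycle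
    and hence is adjacent to all of it. *)
Lemma collapse_complete c v a : cyc c -> off c v -> R v (c a) -> R v (c a.+1) ->
  complete_on c.
Proof.
move=> cc ov va vSa i j ne; have vall := off_all cc ov va vSa.
have ccs := cyc_swap cc ov (vall i.+1); have os := off_swap (m := i) cc ov.
have -> : c j = swap c i v j by rewrite swapN //; apply: nesym.
apply: (off_all ccs os (a := i)); first by rewrite swapE symR.
rewrite swapN //; first by case: cc.
by move=> E; case: cc => cR _; have := cR i; rewrite E irrR.
Qed.

(** Adjacency moves from [c m] to [c m.+1] by the path z, c_m, c_(m+2), .., c_(m+K-1), c_(m+1). *)
Lemma complete_attach c z i : cyc c -> complete_on c -> off c z -> R z (c i) ->
  forall j, R z (c j).
Proof.
move=> cc full oz zi.
have step m : R z (c m) -> R z (c m.+1).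
  move=> zm.
  pose w n := if n == 0 then z else if n == 1 then c (m + 0) else
    if n < K then c (m + n) else c (m + 1).
  have -> : c m.+1 = w K by rewrite /w ltnn addn1; case: K K_gt1 => [|[]].
  apply: (@closedR w) => [n ltnK|n1 n2 le1 le2].
    rewrite /w; case: n ltnK => [|[|n]] ltnK /=; first by rewrite addn0.
      by case: ifP => h; apply: full => /(cyc_inj cc); lia.
    rewrite ltnK; case: ifP => h; apply: full => /(cyc_inj cc); lia.
  rewrite /w; case: n1 le1 => [|[|n1]] le1; case: n2 le2 => [|[|n2]] le2 //=.
  - by move/oz.
  - by case: ifP => _ /oz.
  - by move/esym/oz.
  - by case: ifP => h /(cyc_inj cc); lia.
  - by case: ifP => h /esym/oz.
  - by case: ifP => h /(cyc_inj cc); lia.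
  - by case: ifP => h1; case: ifP => h2 /(cyc_inj cc); lia.
have H n : R z (c (i + n)) by elim: n => [|n IHn]; rewrite ?addn0 // addnS; apply: step.
move=> j; rewrite -(cycD j i cc).
by have := H (j + i * K.+1 - i); rewrite subnKC //; nia.
Qed.

Definition dominated (c : nat -> T) (v : T) : Prop :=
  (exists i, v = c i) \/ (forall i, R v (c i)).

(** If both vertices are off the cycle, [v] replaces [c 0]. Its neighbour [v'] is then adjacent to
    the vertex two places on, which belongs to [c], and [complete_attach] applies. *)
Lemma dominated_step c v v' : cyc c -> complete_on c ->
  dominated c v -> R v v' -> dominated c v'.
Proof.
move=> cc full dv Rvv'.
have [ov'|] := offPn v' cc; last by left.
right; have [ov|[i vi]] := offPn v cc; last first.
  by apply: (complete_attach (i := i)) => //; rewrite symR -vi.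
have vall : forall i, R v (c i) by case: dv => // -[i vi]; case: (ov i).
have ccs := cyc_swap cc ov (vall 1).
have os : off (swap c 0 v) v'.
  move=> i; rewrite /swap; case: ifP => _; last exact: ov'.
  by move=> E; rewrite E irrR in Rvv'.
have : R v' (swap c 0 v (0 + 2)) by apply: off_add2 => //; rewrite swapE symR.
rewrite swapN //; first by apply: complete_attach.
exact: cyc_neSS.
Qed.

(** Two vertices off the cycle are joined through c_1, .., c_(K-1). *)
Lemma dominated_adj c x y : cyc c -> complete_on c ->
  dominated c x -> dominated c y -> x <> y -> R x y.
Proof.
move=> cc full dx dy nxy.
have [ox|[i xi]] := offPn x cc; last first.
  case: dy => [[j yj]|]; first by subst; apply: full.
  by rewrite symR xi; apply.
have [oy|[j yj]] := offPn y cc; last first.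
  by rewrite yj; case: dx => // -[i xi]; case: (ox i).
have xall : forall i, R x (c i) by case: dx => // -[i xi]; case: (ox i).
have yall : forall i, R y (c i) by case: dy => // -[i yi]; case: (oy i).
pose w n := if n == 0 then x else if n < K then c (0 + n) else y.
have -> : y = w K by rewrite /w ltnn; case: K K_gt1.
apply: (@closedR w) => [n ltnK|n1 n2 le1 le2]; rewrite /w.
  case: n ltnK => [|n] ltnK /=; first by rewrite K_gt1.
  by rewrite ltnK; case: ifP => h; [case: cc | rewrite symR].
case: n1 le1 => [|n1] le1; case: n2 le2 => [|n2] le2 //=.
- by case: ifP => _ => [/ox|].
- by case: ifP => _ => [/esym/ox|/esym].
- case: ifP => h1; case: ifP => h2; first by move/(cyc_inj cc); lia.
  + by move/esym/oy.
  + by move/oy.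
  + lia.
Qed.

Lemma dominated_walk c g w : cyc c -> complete_on c ->
  dominated c (w 0) -> walk R g w -> dominated c (w g).
Proof.
move=> cc full d0; elim: g => // g IHg wR.
apply: (dominated_step cc full (IHg _) (wR g _)) => // i ltig; apply: wR; exact: ltnW.
Qed.

(** * Complete bipartite saturated components *)

Definition typed (c : nat -> T) (b : bool) (v : T) : Prop :=
  (off c v /\ R v (c b)) \/ (exists2 i, odd i = ~~ b & v = c i).

(** Such a chord breaks bipartiteness. If [z] can replace the end [c i], then [c i] is off the new
    cycle and has neighbours of both parities on it; otherwise the chord is first shifted by one. *)
Lemma chord_collapsing c z i0 i j : odd K -> cyc c -> off c z -> R z (c i0) ->
  odd i = odd j -> R (c i) (c j) -> collapsing c.
Proof.
move=> oddK cc oz zi0.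
have main i' j' : odd i' != odd i0 -> odd i' = odd j' -> R (c i') (c j') -> collapsing c.
  move=> ni0 oij Rij.
  have zi : R z (c i'.+1).
    by apply: (off_parity cc oz zi0); move: ni0 => /=; case: (odd i') (odd i0) => [] [].
  have nij : c j' <> c i' by move=> E; rewrite E irrR in Rij.
  have ccs := cyc_swap cc oz zi; have os := off_swap (m := i') cc oz.
  have swS : swap c i' z i'.+1 = c i'.+1.
    by rewrite swapN // => E; case: cc => cR _; have := cR i'; rewrite E irrR.
  exists (swap c i' z), (c i'), j', i'.+1; split=> //; first by rewrite swapN.
  apply: (off_parity ccs os (i := i'.+1)); last by rewrite /= oij.
  by rewrite swS; case: cc.
move=> oij Rij; case: (odd i =P odd i0) => [E|/eqP]; last by move=> ne; apply: main Rij.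
apply: (main i.+1 j.+1); rewrite ?/= ?E ?oij //.
- by case: (odd i0).
- by rewrite -oij E.
- exact: chord_shift.
Qed.

(** [b] is the parity of the indices of the neighbours of [v] on the cycle. An edge that does not
    flip it collapses the component; if both ends are off the cycle, [v] is first exchanged for a
    vertex of the cycle. *)
Lemma typed_step c z i0 b v v' : odd K -> cyc c -> off c z -> R z (c i0) ->
  typed c b v -> R v v' -> collapsing c \/ typed c (~~ b) v'.
Proof.
move=> oddK cc oz zi0 tv Rvv'.
have [ov'|[j v'j]] := offPn v' cc; last first.
  case: (odd j =P b) => [E|NE]; first by right; right; exists j; rewrite ?negbK.
  left; have oj : odd j = ~~ b by case: (odd j) (b) NE => [] [].
  case: tv => [[ov vb]|[i oi vi]].
    exists c, v, j, 0; split=> //; first by rewrite -v'j.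
    by apply: (off_parity cc ov vb); rewrite /= oj oddb; case: (b).
  apply: (chord_collapsing oddK cc oz zi0 (i := i) (j := j)); first by rewrite oi oj.
  by rewrite -vi -v'j.
right; left; split=> //.
case: tv => [[ov vb]|[i oi vi]]; last first.
  apply: (off_parity cc ov' (i := i)); first by rewrite symR -vi.
  by rewrite oi oddb.
pose m : nat := ~~ b.
have vm : R v (c m.+1).
  by apply: (off_parity cc ov vb); rewrite /m /= !oddb; case: (b).
have ccs := cyc_swap cc ov vm.
have os : off (swap c m v) v'.
  move=> i; rewrite /swap; case: ifP => _; last exact: ov'.
  by move=> E; rewrite E irrR in Rvv'.
have : R v' (swap c m v (m + 2)) by apply: off_add2 => //; rewrite swapE symR.
rewrite swapN //; last by rewrite addn2; apply: cyc_neSS.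
by move/(off_parity cc ov'); apply; rewrite oddD addbF.
Qed.

Lemma typed_walk c z i0 b g w : odd K -> cyc c -> off c z -> R z (c i0) ->
  typed c b (w 0) -> walk R g w -> collapsing c \/ typed c (b (+) odd g) (w g).
Proof.
move=> oddK cc oz zi0 tb; elim: g => [|g IHg] wR; first by right; rewrite addbF.
have [||tg] := IHg; first by move=> i ltig; apply: wR; apply: ltnW.
  by left.
by rewrite /= addbN; apply: (typed_step oddK cc oz zi0 tg); apply: wR.
Qed.

(** On the cycle itself, [c i] is exchanged for [z] and treated as a vertex off the cycle. Two
    vertices off the cycle are joined through c_b, .., c_(b+K-2), whose last index has the parity
    required by [y] since [K] is odd. *)
Lemma typed_adj c z i0 b x y : odd K -> cyc c -> off c z -> R z (c i0) ->
  typed c b x -> typed c (~~ b) y -> x <> y -> R x y.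
Proof.
move=> oddK cc oz zi0.
have both i j : odd i != odd j -> R (c i) (c j).
  have main i' j' : odd i' != odd i0 -> odd i' != odd j' -> R (c i') (c j').
    move=> ni0 nij.
    have zi : R z (c i'.+1).
      by apply: (off_parity cc oz zi0); move: ni0 => /=; case: (odd i') (odd i0) => [] [].
    have ccs := cyc_swap cc oz zi; have os := off_swap (m := i') cc oz.
    have : R (c i') (swap c i' z j').
      apply: (off_parity ccs os (i := i'.+1)).
        rewrite swapN //; first by case: cc.
        by move=> E; case: cc => cR _; have := cR i'; rewrite E irrR.
      by move: nij => /=; case: (odd i') (odd j') => [] [].
    rewrite swapN // => E.
    have [_ cE] := cc; move/cE: E => E.
    have : odd (j' %% K.+1) = odd (i' %% K.+1) by rewrite E.
    have oddm u : odd (u %% K.+1) = odd u.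
      by rewrite [in RHS](divn_eq u K.+1) oddD oddM /= oddK andbF.
    by rewrite !oddm => h; rewrite h eqxx in nij.
  move=> nij; case: (odd i =P odd i0) => [E|/eqP ne]; last exact: main.
  by rewrite symR; apply: main; rewrite -?E eq_sym.
case=> [[ox xb]|[i oi xi]]; case=> [[oy yb]|[j oj yj]] nxy.
- pose w n := if n == 0 then x else if n < K then c (b + n.-1) else y.
  have -> : y = w K by rewrite /w ltnn; case: K K_gt1.
  apply: (@closedR w) => [n ltnK|n1 n2 le1 le2]; rewrite /w.
    case: n ltnK => [|n] ltnK /=; first by rewrite K_gt1 addn0.
    rewrite ltnK; case: ifP => h; first by rewrite addnS; case: cc.
    rewrite symR; apply: (off_parity cc oy yb).
    have -> : n = K - 2 by lia.
    by rewrite oddD oddB // oddK /= !oddb; case: (b).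
  case: n1 le1 => [|n1] le1; case: n2 le2 => [|n2] le2 //=.
  + by case: ifP => _ => [/ox|].
  + by case: ifP => _ => [/esym/ox|/esym].
  + case: ifP => h1; case: ifP => h2; first by move/(cyc_inj cc); lia.
    * by move/esym/oy.
    * by move/oy.
    * lia.
- rewrite yj; apply: (off_parity cc ox xb); by rewrite oj negbK oddb.
- rewrite xi symR; apply: (off_parity cc oy yb); by rewrite oi oddb.
- by rewrite xi yj; apply: both; rewrite oi oj; case: (b).
Qed.

Lemma cyc_of_path w : walk R K w -> inj_upto K w -> cyc (fun i => w (i %% K.+1)).
Proof.
move=> wR wI.
have lt i : i %% K.+1 <= K by rewrite -ltnS ltn_mod.
split=> [i|i j]; last by split=> [/wI|->] //; apply.
rewrite -[i.+1]addn1 -modnDml addn1.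
case: (ltnP (i %% K.+1) K) => [h|h].
  by rewrite [X in R _ (w X)]modn_small //; apply: wR.
have -> : i %% K.+1 = K by have := lt i; lia.
by rewrite modnn symR; apply: closedR.
Qed.

(** The path closes to a cycle with an outside neighbour [z]. For even [K] one turn is odd, so [z]
    sees both parities and the component is complete. For odd [K] it is complete or complete
    bipartite, and an odd walk joins opposite classes. The walk [u] places [v] in this component. *)
Theorem saturated_adj w z i0 u d v g :
  walk R K w -> inj_upto K w -> i0 <= K -> R z (w i0) ->
  (forall i, i <= K -> z <> w i) ->
  walk R d u -> u 0 = w 0 ->
  walk R g v -> v 0 = u d -> v 0 <> v g -> (odd K -> odd g) ->
  R (v 0) (v g).
Proof.
move=> wR wI lei0 zi0 nz uR u0 vR v0 nvg og.
pose c i := w (i %% K.+1).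
have cc : cyc c := cyc_of_path wR wI.
have oz : off c z by move=> i; apply: nz; rewrite -ltnS ltn_mod.
have {}zi0 : R z (c i0) by rewrite /c modn_small.
have c0 : c 0 = w 0 by rewrite /c mod0n.
have coll : collapsing c -> R (v 0) (v g).
  case=> c' [v' [a [m [cc' ov' va va1 cm]]]].
  have full := collapse_complete cc' ov' va va1.
  have dx : dominated c' (u 0).
    rewrite u0 -c0 -(cycD 0 m cc).
    (* From the common vertex, [m * K] steps along [c] end at index [m * K.+1], that is at [c 0]. *)
    have := @dominated_walk c' (m * K) (fun i => c (m + i)) cc' full.
    rewrite /= addn0 -mulnS; apply; first by left; exists m.
    by move=> i _; rewrite addnS; case: cc.
  have dy := dominated_walk cc' full dx uR; rewrite -v0 in dy.
  have dz := dominated_walk cc' full dy vR.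
  exact: (dominated_adj cc' full dy dz).
case: (boolP (odd K)) => [oddK|evenK]; last first.
  apply: coll; exists c, z, i0, 0; split=> //.
  rewrite -(cycD i0.+1 1 cc) mul1n.
  by apply: (off_parity cc oz zi0); rewrite oddD /= (negbTE evenK); case: (odd i0).
have t0 : typed c true (u 0) by right; exists 0; rewrite // u0.
case: (typed_walk oddK cc oz zi0 t0 uR) => [//|tx].
rewrite -v0 in tx.
case: (typed_walk oddK cc oz zi0 tx vR) => [//|].
rewrite og // addbT => ty.
exact: (typed_adj oddK cc oz zi0 tx ty).
Qed.

End Saturated.

(** * The process near a short path *)

Section Bootstrap.

Variables (T : finType) (K : nat).
Hypothesis K_gt1 : 1 < K.

Local Notation boot := (bootstrap (cycle_graph K.+1)).
Implicit Types G H : {set {set T}}.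

Lemma bootS G i : boot G i.+1 = bootstrap_step (cycle_graph K.+1) (boot G i).
Proof. by []. Qed.

Lemma boot_add G i j : boot (boot G i) j = boot G (i + j).
Proof. by rewrite /bootstrap addnC iterD. Qed.

Lemma simple_boot G i : simple_graph G -> simple_graph (boot G i).
Proof. by move=> sG; elim: i => // i; rewrite bootS; apply: simple_step. Qed.

Lemma boot_sub G i j : i <= j -> boot G i \subset boot G j.
Proof.
move/subnK <-; elim: (j - i) => // n IHn.
by apply: subset_trans IHn _; rewrite addSn bootS; apply: subsetUl.
Qed.

Lemma adj_bootS G i x y : simple_graph G ->
  adj (boot G i.+1) x y <->
  adj (boot G i) x y \/
  exists w, [/\ w 0 = x, w K = y, inj_upto K w & walk (adj (boot G i)) K w].
Proof. by move=> sG; rewrite bootS; apply: adj_step => //; apply: simple_boot. Qed.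

Lemma adj_boot_leq G i j x y : i <= j -> adj (boot G i) x y -> adj (boot G j) x y.
Proof. by move=> leij; apply: (subsetP (boot_sub G leij)). Qed.

Lemma walkW (R R' : rel T) g w : (forall x y, R x y -> R' x y) ->
  walk R g w -> walk R' g w.
Proof. by move=> sRR' wR i ltig; apply/sRR'/wR. Qed.

Lemma simple_subset G H : simple_graph G ->
  (forall x y, adj G x y -> adj H x y) -> G \subset H.
Proof.
move=> /subsetP sG sGH; apply/subsetP=> e eG.
have := sG _ eG; rewrite inE => /cards2P[x [y [_ Ee]]].
by rewrite Ee; apply: sGH; rewrite /adj -Ee.
Qed.

Lemma boot_mono G H i : simple_graph G -> simple_graph H ->
  G \subset H -> boot G i \subset boot H i.
Proof.
move=> sG sH sGH; elim: i => // i IHi.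
apply: simple_subset; first exact: simple_boot.
move=> x y /(adj_bootS _ _ _ sG) xy; apply/adj_bootS => //.
have sub a b : adj (boot G i) a b -> adj (boot H i) a b by apply: (subsetP IHi).
case: xy => [/sub|[w [w0 wK wI wR]]]; [by left | right].
by exists w; split=> //; apply: walkW wR.
Qed.

Lemma boot_stable G i j : boot G i = boot G i.+1 -> i <= j -> boot G j = boot G i.
Proof.
move=> E /subnK <-; elim: (j - i) => // n IHn.
by rewrite addSn bootS IHn -bootS.
Qed.

Definition within (S : {set T}) G : Prop := forall x y, adj G x y -> x \in S.

Lemma within_boot S G i : simple_graph G -> within S G -> within S (boot G i).
Proof.
move=> sG wG; elim: i => // i IHi x y /(adj_bootS _ _ _ sG)[|[w [<- _ _ wR]]].
  exact: IHi.
by apply: IHi (w 1) _; apply: wR; lia.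
Qed.

Lemma within_subset S G : simple_graph G -> within S G -> G \subset powerset S.
Proof.
move=> /subsetP sG wG; apply/subsetP=> e eG.
have := sG _ eG; rewrite inE => /cards2P[x [y [_ Ee]]].
have Exy : adj G x y by rewrite /adj -Ee.
rewrite inE; apply/subsetP=> z; rewrite Ee !inE => /orP[]/eqP->.
  exact: wG Exy.
by apply: (wG y x); rewrite adj_sym.
Qed.

(** All edges are subsets of [S], so the edge set can grow strictly at most [2 ^ #|S|] times. *)
Lemma within_stable S G j : simple_graph G -> within S G -> 2 ^ #|S| <= j ->
  boot G j = boot G j.+1.
Proof.
move=> sG wG lej.
have [i lei E] : exists2 i, i <= 2 ^ #|S| & boot G i = boot G i.+1.
  pose N := (2 ^ #|S|).+1.
  case: (boolP [exists t : 'I_N, boot G t == boot G t.+1]).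
    by case/existsP=> t /eqP E; exists t => //; rewrite -ltnS ltn_ord.
  rewrite negb_exists => /forallP neq.
  have grow t : t <= N -> t <= #|boot G t|.
    elim: t => // t IHt lt_tN; apply: leq_ltn_trans (IHt (ltnW lt_tN)) _.
    by apply: proper_card; rewrite properEneq (neq (Ordinal lt_tN)) boot_sub.
  have := subset_leq_card (within_subset (simple_boot N sG) (within_boot sG wG)).
  move=> /(leq_trans (grow N (leqnn N))).
  by rewrite card_powerset ltnn.
by rewrite (boot_stable E (leq_trans lei lej)) (boot_stable E (leqW (leq_trans lei lej))).
Qed.

(* An anchored vertex lies in a component with more than K + 1 vertices that
   contains a path with K edges. In any other component the process stops within
   a time that depends on K only. *)
Definition anchored_at (d : nat) (G : {set {set T}}) (x : T) : Prop :=
  exists w z i0,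
    [/\ walk (adj G) K w, inj_upto K w, i0 <= K /\ adj G z (w i0),
        (forall i, i <= K -> z <> w i) & reach (adj G) d x (w 0)].

Definition anchored G x : Prop := exists d, anchored_at d G x.

(* A shortest connection from x longer than K starts with a path of K + 1 edges,
   which is itself an anchor. *)
Lemma anchored_near G x : anchored G x -> exists2 d, d <= K & anchored_at d G x.
Proof.
case=> d; elim/ltn_ind: d => d IHd an; case: (leqP d K) => [ledK|ltKd].
  by exists d.
have [w [z [i0 [wR wI zi0 nz [u [uR u0 ud]]]]]] := an.
case: (inj_uptoPn K.+1 u) => [uI|[i [j [/andP[ltij lejK] uij]]]]; last first.
  have hij : i < j <= d by rewrite ltij (leq_trans lejK).
  apply: (IHd (d - (j - i))); first lia.
  exists w, z, i0; split=> //; rewrite -u0 -ud.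
  exact: reach_short uR hij uij.
exists 0 => //; exists u, (u K.+1), K; split=> //.
- by move=> i ltiK; apply: uR; lia.
- by move=> i j lei lej; apply: uI; lia.
- by split=> //; rewrite adj_sym; apply: uR.
- by move=> i leiK /uI; lia.
- by exists (fun=> x); rewrite u0.
Qed.

Lemma anchored_walk G g v : walk (adj G) g v -> anchored G (v g) -> anchored G (v 0).
Proof.
move=> vR [d [w [z [i0 [wR wI zi0 nz r]]]]].
exists (g + d), w, z, i0; split=> //.
by apply: reach_cat r; exists v.
Qed.

Lemma anchored_sub G H x : (forall a b, adj G a b -> adj H a b) ->
  anchored G x -> anchored H x.
Proof.
move=> sGH [d [w [z [i0 [wR wI [lei0 zi0] nz [u [uR u0 ud]]]]]]].
exists d, w, z, i0; split=> //; first exact: walkW wR.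
  by split=> //; apply: sGH.
by exists u; split=> //; apply: walkW uR.
Qed.

Lemma anchored_adj G g v : simple_graph G -> anchored G (v 0) ->
  walk (adj G) g v -> v 0 <> v g -> (odd K -> odd g) ->
  adj (boot G (2 ^ (2 * K + g + 4))) (v 0) (v g).
Proof.
move=> sG /anchored_near[d ledK [w [z [i0 [wR wI [lei0 zi0] nz [u [uR u0 ud]]]]]]] vR nv og.
pose S := [set w i | i : 'I_K.+1] :|: [set z] :|: [set u i | i : 'I_d.+1]
  :|: [set v i | i : 'I_g.+1].
have cS : #|S| <= 2 * K + g + 4.
  apply: leq_trans (leq_card_setU _ _) _.
  have h1 := leq_card_setU ([set w i | i : 'I_K.+1] :|: [set z]) [set u i | i : 'I_d.+1].
  have h2 := leq_card_setU [set w i | i : 'I_K.+1] [set z].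
  have im n (f : nat -> T) : #|[set f i | i : 'I_n]| <= n.
    by apply: leq_trans (leq_imset_card _ _) _; rewrite card_ord.
  have := im K.+1 w; have := im d.+1 u; have := im g.+1 v.
  by move: h1 h2 => [h1 _] [h2 _]; move: h1 h2; rewrite cards1; lia.
have inS n (f : nat -> T) i : [set f i | i : 'I_n.+1] \subset S -> i <= n -> f i \in S.
  by move=> /subsetP sS lein; apply: sS; apply/imsetP; exists (inord i); rewrite ?inordK.
have wS i : i <= K -> w i \in S by apply: inS; rewrite /S -!setUA subsetUl.
have uS i : i <= d -> u i \in S by apply: inS; rewrite /S setUAC subsetUr.
have vS i : i <= g -> v i \in S by apply: inS; rewrite /S subsetUr.
have zS : z \in S by rewrite !inE eqxx orbT.
pose H := [set e in G | e \subset S].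
have sHG : H \subset G by apply/subsetP=> e; rewrite inE => /andP[].
have sH : simple_graph H by apply: subset_trans sHG sG.
have wH : within S H.
  by move=> x y; rewrite /adj inE => /andP[_ /subsetP]; apply; rewrite set21.
have adjH x y : x \in S -> y \in S -> adj G x y -> adj H x y.
  move=> xS yS xy; rewrite /adj inE; apply/andP; split=> //.
  by apply/subsetP=> t; rewrite in_set2 => /orP[]/eqP->.
have stab := within_stable sH wH (leqnn _).
set N := 2 ^ #|S| in stab.
have up x y : adj H x y -> adj (boot H N) x y by apply: (@adj_boot_leq H 0 N).
have /(subsetP (boot_mono N sH sG sHG)) : [set v 0; v g] \in boot H N.
  apply: (@saturated_adj _ (adj (boot H N)) K K_gt1 _ _ _ w z i0 (fun i => u (d - i)) d v g) => //.
  - exact: adj_sym.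
  - by move=> x; apply/negbTE/negP=> /(adj_neq (simple_boot _ sH)); rewrite eqxx.
  - move=> w' wR' wI'; rewrite stab; apply/adj_bootS => //; right.
    by exists w'.
  - by move=> i ltiK; apply/up/adjH; [apply: wS; lia | apply: wS | apply: wR].
  - by apply/up/adjH => //; apply: wS.
  - apply: walk_rev; first exact: adj_sym.
    by move=> i ltid; apply/up/adjH; [apply: uS; lia | apply: uS | apply: uR].
  - by rewrite subn0.
  - by move=> i ltig; apply/up/adjH; [apply: vS; lia | apply: vS | apply: vR].
  - by rewrite subnn.
apply: (subsetP (boot_sub _ _)).
by rewrite leq_exp2l.
Qed.

End Bootstrap.

(** * Distances along a path *)

Definition semigroup (K s : nat) : Prop :=
  exists a b, s = a * (K - 1) + b * (K + 1).

Lemma semigroupI K j b : 0 < K -> b <= j -> semigroup K (j * (K - 1) + b.*2).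
Proof. by move=> K_gt0 lebj; exists (j - b), b; nia. Qed.

(** Division by [K - 1] leaves an even remainder, and the quotient is large enough for half the
    remainder to count summands raised to [K + 1]. *)
Lemma semigroup_odd K s : odd K -> ~~ odd s -> (K - 1) * (K - 2) <= s ->
  semigroup K s.
Proof.
move=> oddK evs les; have K_gt0 : 0 < K by case: K oddK {les}.
case: (posnP (K - 1)) => [K1|K1_gt0].
  by exists 0, s./2; have := even_halfK evs; nia.
have oK1 : ~~ odd (K - 1) by rewrite oddB // oddK.
have ltm : s %% (K - 1) < K - 1 by rewrite ltn_mod.
have Em : (s %% (K - 1))./2.*2 = s %% (K - 1).
  apply: even_halfK; move: evs; rewrite {1}(divn_eq s (K - 1)) oddD oddM.
  by rewrite (negbTE oK1) andbF.
have leq : K - 2 <= s %/ (K - 1) by rewrite leq_divRL // mulnC.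
rewrite (divn_eq s (K - 1)) -Em; apply: semigroupI => //; lia.
Qed.

(** The Frobenius number of the coprime numbers [K - 1] and [K + 1] is [K * (K - 2) - 1]. An odd
    remainder is made even by borrowing one [K - 1] from the quotient. *)
Lemma semigroup_even K s : 0 < K -> ~~ odd K -> K * (K - 2) <= s -> semigroup K s.
Proof.
move=> K_gt0 evK les.
have K_gt1 : 1 < K by case: K K_gt0 evK {les} => [|[]].
have oK1 : odd (K - 1) by rewrite oddB // (negbTE evK).
have K1_gt0 : 0 < K - 1 by lia.
have ltm : s %% (K - 1) < K - 1 by rewrite ltn_mod.
have E := divn_eq s (K - 1).
have leq : K - 2 <= s %/ (K - 1) by rewrite leq_divRL //; nia.
case: (boolP (odd (s %% (K - 1)))) => om; last first.
  by rewrite E -(even_halfK om); apply: semigroupI => //; lia.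
have leq' : K - 1 <= s %/ (K - 1).
  rewrite leqNgt; apply/negP=> lt.
  have e1 : s %/ (K - 1) = K - 2 by lia.
  have e2 : s %% (K - 1) = K - 2 by rewrite e1 in E; nia.
  by move: om; rewrite e2 oddB // (negbTE evK).
have ev : ~~ odd (K - 1 + s %% (K - 1)) by rewrite oddD oK1 om.
have -> : s = (s %/ (K - 1) - 1) * (K - 1) + (K - 1 + s %% (K - 1))./2.*2.
  by rewrite (even_halfK ev); nia.
apply: semigroupI => //.
rewrite -leq_double (even_halfK ev).
have : s %% (K - 1) != K - 2.
  by apply: contraTneq om => ->; rewrite oddB // (negbTE evK).
lia.
Qed.

Lemma semigroup_large K s : 1 < K -> (odd K -> ~~ odd s) -> K * (K - 2) <= s ->
  semigroup K s.
Proof.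
move=> K_gt1 par les; case: (boolP (odd K)) => oK.
  by apply: semigroup_odd => //; [exact: par | nia].
by apply: semigroup_even => //; lia.
Qed.

Lemma sumn_takeS s j : j < size s -> sumn (take j.+1 s) = sumn (take j s) + nth 0 s j.
Proof. by move=> ltj; rewrite (take_nth 0) // sumn_rcons. Qed.

Section Paths.

Variables (T : finType) (K : nat).
Hypothesis K_gt1 : 1 < K.

Local Notation boot := (bootstrap (cycle_graph K.+1)).
Implicit Types G : {set {set T}}.

Lemma chain_adj G t v : simple_graph G ->
  walk (adj G) (K ^ t) v -> inj_upto (K ^ t) v -> adj (boot G t) (v 0) (v (K ^ t)).
Proof.
move=> sG; elim: t v => [|t IHt] v vR vI; first by apply: vR.
apply/adj_bootS => //; right; exists (fun j => v (j * K ^ t)); split=> //.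
- by rewrite expnS.
- move=> i j lei lej /vI.
  have B0 : 0 < K ^ t by rewrite expn_gt0; lia.
  have le x : x <= K -> x * K ^ t <= K ^ t.+1 by move=> h; rewrite expnS leq_pmul2r.
  by move=> /(_ (le _ lei) (le _ lej)) /eqP; rewrite eqn_pmul2r // => /eqP.
- move=> j ltj; rewrite /= mulSn addnC.
  have le : j * K ^ t + K ^ t <= K ^ t.+1 by rewrite addnC -mulSn expnS leq_mul2r ltj orbT.
  have := IHt (fun m => v (j * K ^ t + m)); rewrite addn0; apply.
    by move=> i lti; rewrite addnS; apply: vR; lia.
  by move=> a b lea leb /vI; lia.
Qed.

(** The cut points form a path with [K ^ t] edges in [boot G i]; positive gaps keep them
    distinct. *)
Lemma gaps_adj G i t n w (s : seq nat) : simple_graph G -> inj_upto n w ->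
  (forall a g, g \in s -> a + g <= n -> 0 < g /\ adj (boot G i) (w a) (w (a + g))) ->
  size s = K ^ t -> sumn s = n -> adj (boot G (i + t)) (w 0) (w n).
Proof.
move=> sG wI gapR ss es; rewrite -boot_add.
have le j : sumn (take j s) <= n.
  by rewrite -es -{2}(cat_take_drop j s) sumn_cat leq_addr.
have gapj j : j < size s -> 0 < nth 0 s j /\
    adj (boot G i) (w (sumn (take j s))) (w (sumn (take j.+1 s))).
  move=> ltj; rewrite sumn_takeS //; apply: gapR; first exact: mem_nth.
  by rewrite -sumn_takeS.
have mono a b : a < b -> b <= size s -> sumn (take a s) < sumn (take b s).
  elim: b => // b IHb; rewrite ltnS leq_eqVlt => /orP[/eqP ->|ltab] leb.
    by rewrite sumn_takeS //; have [] := gapj _ leb; lia.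
  rewrite sumn_takeS //; have := IHb ltab (ltnW leb); lia.
have := @chain_adj (boot G i) t (fun j => w (sumn (take j s))).
rewrite /= take0 -ss take_size es; apply.
- exact: simple_boot.
- by move=> j ltj; case: (gapj j ltj).
move=> a b lea leb /wI E; have {}E := E (le a) (le b).
by case: (ltngtP a b) => // h; [have := mono _ _ h leb | have := mono _ _ h lea]; lia.
Qed.

Lemma hop_adj G i n w q : simple_graph G -> inj_upto n w ->
  (forall j, j <= K -> q j <= n) -> inj_upto K q ->
  (forall j, j < K -> adj (boot G i) (w (q j)) (w (q j.+1))) ->
  adj (boot G i.+1) (w (q 0)) (w (q K)).
Proof.
move=> sG wI leq qI qR; apply/adj_bootS => //; right.
exists (w \o q); split=> // a b lea leb /= /wI E; apply: qI => //.
by apply: E; apply: leq.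
Qed.

Lemma jump_adj G n w a : simple_graph G -> walk (adj G) n w -> inj_upto n w ->
  a + K <= n -> adj (boot G 1) (w a) (w (a + K)).
Proof.
move=> sG wR wI lea.
have := @hop_adj G 0 n w (fun j => a + j) sG wI; rewrite addn0; apply.
- by move=> j lej; lia.
- by move=> i j _ _; lia.
- by move=> j ltj; rewrite addnS; apply: wR; lia.
Qed.

(* K jumps by K; K - 1 jumps and a unit step; K - 1 jumps and a backward unit
   step, taken after the first jump so that the path stays between its ends. *)
Lemma level2_adj G n w a g : simple_graph G -> walk (adj G) n w -> inj_upto n w ->
  g \in [:: 1; K * K - (K - 1); K * K - (K + 1); K * K] -> a + g <= n ->
  0 < g /\ adj (boot G 2) (w a) (w (a + g)).
Proof.
move=> sG wR wI gin leag.
have jump b : b + K <= n -> adj (boot G 1) (w b) (w (b + K)) by apply: jump_adj.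
have unit1 b : b < n -> adj (boot G 1) (w b) (w b.+1).
  by move=> ltb; apply: (@adj_boot_leq _ _ G 0) => //; apply: wR.
have unit2 b : b < n -> adj (boot G 2) (w b) (w b.+1).
  by move=> ltb; apply: (@adj_boot_leq _ _ G 0) => //; apply: wR.
split; first by move: gin; rewrite !inE => /or4P[] /eqP->; nia.
move: gin leag; rewrite !inE => /or4P[] /eqP-> leag.
- by rewrite addn1; apply: unit2; lia.
- pose q j := if j is j'.+1 then a + 1 + j' * K else a.
  have qK : a + (K * K - (K - 1)) = q K by rewrite /q; case: K K_gt1 => // K'; nia.
  rewrite qK; apply: (@hop_adj G 1 n w q) => // [j lej|[|i] [|j] //= |j ltj].
  + apply: leq_trans leag; rewrite qK /q; case: j lej => [|j] lej; first by case: (K); lia.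
    by case: K K_gt1 lej => // K' _ lej; rewrite leq_add2l leq_mul2r; lia.
  + by lia.
  + by lia.
  + by move=> _ _ /eqP; rewrite eqn_add2l eqn_pmul2r ?(ltnW K_gt1) // => /eqP->.
  + have lej : q j.+1 <= n.
      apply: leq_trans leag; rewrite qK /q; case: K K_gt1 ltj => // K' _ ltj.
      by rewrite leq_add2l leq_mul2r; lia.
    move: lej; case: j ltj => [|j] ltj /= lej.
      by rewrite mul0n addn0 addn1; apply: unit1; lia.
    have E : a + 1 + j.+1 * K = a + 1 + j * K + K by rewrite mulSn; lia.
    by rewrite E; apply: jump; rewrite -E.
- case: (ltnP K 3) => [ltK3|leK3].
    have -> : K * K - (K + 1) = 1 by nia.
    by rewrite addn1; apply: unit2; nia.
  (* The positions are a, a + K, a + K - 1, a + 2K - 1, .., a + (K - 1)K - 1. *)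
  pose q j := if j is j'.+1 then (if j' == 0 then a + K else a + j' * K - 1) else a.
  have qE j : 0 < j -> q j.+1 = a + j * K - 1 by case: j.
  have qK : a + (K * K - (K + 1)) = q K.
    have -> : q K = a + (K - 1) * K - 1.
      by rewrite -qE; [congr (q _); lia | lia].
    by nia.
  have bd j : 0 < j < K -> K - 1 <= j * K - 1 <= K * K - (K + 1).
    by move=> /andP[j0 jK]; nia.
  rewrite qK; apply: (@hop_adj G 1 n w q) => // [j lej|i j|j ltj].
  + apply: leq_trans leag; case: j lej => [|[|j]] lej /=; try nia.
  + have far x : K - 1 <= x.+1 * K - 1 /\ (0 < x -> K < x.+1 * K - 1) by split; nia.
    case: i => [|[|i]]; case: j => [|[|j]] //= lei lej E.
    * by lia.
    * by have := far j; lia.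
    * by lia.
    * by have := far j; case: (j) E => [|j'] E; rewrite ?mul1n in E *; lia.
    * by have := far i; lia.
    * by have := far i; case: (i) E => [|i'] E; rewrite ?mul1n in E *; lia.
    * suff /eqP : i.+1 * K = j.+1 * K by rewrite eqn_pmul2r ?(ltnW K_gt1) // => /eqP [->].
      by have := far i; have := far j; lia.
  + case: j ltj => [|[|j]] ltj /=.
    * by apply: jump; nia.
    * have E : a + K = (a + K - 1).+1 by lia.
      by rewrite mul1n adj_sym {2}E; apply: unit1; nia.
    * have -> : a + j.+2 * K - 1 = a + j.+1 * K - 1 + K by nia.
      by apply: jump; nia.
- pose q j := a + j * K.
  have E : w a = w (q 0) by rewrite /q addn0.
  rewrite E; apply: (@hop_adj G 1 n w q) => // [j lej|i j _ _|j ltj]; rewrite /q.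
  + by apply: leq_trans leag; rewrite leq_add2l leq_mul2r lej orbT.
  + by move/eqP; rewrite eqn_add2l eqn_pmul2r ?(ltnW K_gt1) // => /eqP->.
  + have Ej : a + j.+1 * K = a + j * K + K by rewrite mulSn; lia.
    rewrite Ej; apply: jump; rewrite -Ej; apply: leq_trans leag.
    by rewrite leq_add2l leq_mul2r ltj orbT.
Qed.

(* K ^ t pieces of the four lengths of level2_adj; pieces of length 1 stand for
   s = (K - 1) * (K + 1). *)
Lemma long_path_adj G t w g s : simple_graph G -> walk (adj G) g w -> inj_upto g w ->
  g + s = K ^ t.+2 -> semigroup K s -> K ^ t + 2 * K ^ 3 <= g ->
  adj (boot G t.+2) (w 0) (w g).
Proof.
move=> sG wR wI Eg [a [b Es]] leg.
set N := K ^ t in leg.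
have EN : K ^ t.+2 = N * (K * K) by rewrite !expnS mulnA mulnC.
(* One piece of length 1 accounts for [K + 1] summands [K - 1] or for [K - 1] summands [K + 1]; only
   the remainders need pieces of the two intermediate lengths. *)
pose a' := a %% (K + 1); pose b' := b %% (K - 1).
pose c := a %/ (K + 1) + b %/ (K - 1).
have lta : a' <= K by have := ltn_pmod a (ltn0Sn K); rewrite /a' addn1; lia.
have ltb : b' <= K - 2.
  by have : 0 < K - 1 by [lia]; rewrite /b' => /(ltn_pmod b); lia.
have KK : (K - 1) * (K + 1) = K * K - 1 by clear -K_gt1; nia.
have Es' : s = c * (K * K - 1) + a' * (K - 1) + b' * (K + 1).
  rewrite Es {1}(divn_eq a (K + 1)) {1}(divn_eq b (K - 1)) -/a' -/b' /c -KK.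
  move: (a %/ (K + 1)) (b %/ (K - 1)) => x y.
  rewrite (mulnDl _ a') (mulnDl _ b') (mulnDl x y) -!mulnA [(K + 1) * _]mulnC; lia.
have K3 : K ^ 3 = K * (K * K) by rewrite !expnS expn0 muln1.
(* The lower bound on [g] leaves room for the [a' + b'] other pieces. *)
have lec : c + 2 * K <= N.
  rewrite K3 in leg; rewrite EN in Eg.
  have EQ : K * K = (K * K - 1).+1 by rewrite subn1 prednK // muln_gt0; lia.
  have M_gt0 : 0 < K * K - 1 by rewrite subn_gt0 (ltn_mul K_gt1 K_gt1).
  move: (K * K - 1) M_gt0 Es' EQ => M M_gt0 Es' EQ.
  rewrite EQ !mulnS in Eg leg.
  by rewrite -(leq_pmul2r M_gt0) mulnDl -mulnA; lia.
clearbody a' b' c.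
pose e := N - (a' + b' + c).
pose l := nseq c 1 ++ nseq a' (K * K - (K - 1)) ++ nseq b' (K * K - (K + 1)) ++ nseq e (K * K).
rewrite -[t.+2]add2n; apply: (gaps_adj (s := l)) => //.
- move=> x y; rewrite !mem_cat !mem_nseq => yin lexy.
  apply: (level2_adj sG wR wI) => //; rewrite !inE.
  by case/or4P: yin => /andP[_ ->]; rewrite ?orbT.
- rewrite !size_cat !size_nseq -/N /e; lia.
- rewrite !sumn_cat !sumn_nseq.
  have EeN : N = e + a' + b' + c by rewrite /e; lia.
  rewrite EN EeN in Eg.
  have E1 : K * K = (K * K - (K - 1)) + (K - 1) by rewrite subnK //; clear -K_gt1; nia.
  have E2 : K * K = (K * K - (K + 1)) + (K + 1) by rewrite subnK //; clear -K_gt1; nia.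
  have E3 : K * K = (K * K - 1) + 1 by rewrite subnK // muln_gt0; lia.
  move: (K * K) (K - 1) (K + 1) (K * K - (K - 1)) (K * K - (K + 1)) (K * K - 1) Es' Eg E1 E2 E3.
  move=> Q u v P1 P2 M -> Eg E1 E2 E3.
  rewrite !mulnDl [in a' * Q]E1 [in b' * Q]E2 [in c * Q]E3 !mulnDr muln1 in Eg.
  lia.
Qed.

(** By this time [anchored_adj] has settled all walks of length at most [K ^ 5 + 2 * K ^ 3]. *)
Definition path_time : nat := 2 ^ (2 * K + (K ^ 5 + 2 * K ^ 3) + 4).

(** Bounded lengths are left to [anchored_adj], lengths comparable with [K ^ t] to [long_path_adj].
    In between, the deficit from the previous power is large enough for [semigroup_large], so the
    edge is present one step earlier. *)
Lemma path_adj G t w g s : simple_graph G -> anchored K G (w 0) ->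
  walk (adj G) g w -> inj_upto g w -> 0 < g -> (odd K -> odd g) ->
  g + s = K ^ t -> semigroup K s -> path_time <= t ->
  adj (boot G t) (w 0) (w g).
Proof.
move=> sG an wR wI g_gt0 og Eg Ss let0.
set D := K ^ 5 + 2 * K ^ 3 in let0 *.
have K2 : 0 < K by lia.
case: (ltnP g D) => [ltgD|leDg].
  have nw : w 0 <> w g by move/wI; lia.
  apply: adj_boot_leq (anchored_adj K_gt1 sG an wR nw og).
  by apply: leq_trans let0; rewrite leq_exp2l //; lia.
have lt7 : 7 <= t.
  apply: leq_trans let0; apply: leq_trans (leq_pexp2l _ (_ : 4 <= _)) => //; lia.
have {lt7 let0} [u Et leu] : exists2 u, t = u.+2 & 5 <= u.
  by exists t.-2; lia.
rewrite Et in Eg *; elim: u s leu Eg Ss {Et} => // u IHu s leu Eg Ss.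
case: (leqP (K ^ u.+1 + 2 * K ^ 3) g) => [leg|ltg].
  exact: long_path_adj Eg Ss leg.
have leu' : 5 <= u.
  rewrite leqNgt; apply/negP=> ltu5; have Eu : u.+1 = 5 by lia.
  by rewrite Eu in ltg; move: leDg; rewrite /D; lia.
apply: (@adj_boot_leq _ _ _ u.+2); first by [].
have big : g + K * (K - 2) <= K ^ u.+2.
  have h1 : K ^ u.+2 = K * K ^ u.+1 by rewrite expnS.
  have h2 : 4 * K ^ 3 <= K ^ u.+1.
    apply: (@leq_trans (K ^ 2 * K ^ 3)); last by rewrite -expnD leq_exp2l //; lia.
    by rewrite leq_mul2r (@leq_exp2r 2 K 2) // K_gt1 orbT.
  have h3 : K * (K - 2) <= K ^ 3.
    by rewrite !expnS expn0 muln1 leq_mul2l; apply/orP; right; clear -K_gt1; nia.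
  have h4 : 2 * K ^ u.+1 <= K * K ^ u.+1 by rewrite leq_mul2r K_gt1 orbT.
  lia.
have leg : g <= K ^ u.+2 by apply: leq_trans big; apply: leq_addr.
apply: (IHu (K ^ u.+2 - g)) => //; first exact: subnKC.
apply: semigroup_large => //; last by rewrite leq_subRL.
by move=> oK; rewrite oddB // og // oddX oK orbT.
Qed.

End Paths.

(** * Odd walks with concentric coincidences *)

(* With K - 2 summands in all, the number a1 - b1 takes all residues modulo K but
   one; the exceptional residue would force r to be so large that K - 1 summands
   are available. *)
Lemma split_class K p r s : odd K -> 2 < K -> ~~ odd s ->
  (K - 1) * (K - 2) <= s -> (K - 1) * (K - 2) + 2 * r <= s + 2 ->
  2 * p + 2 * r + s = 1 %[mod K] ->
  exists a1 b1 a2 b2,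
    s = (a1 * (K - 1) + b1 * (K + 1)) + (a2 * (K - 1) + b2 * (K + 1)) /\
    K %| p + (a1 * (K - 1) + b1 * (K + 1)).
Proof.
move=> oK K_gt2 evs les lers modE.
have K_gt0 : 0 < K by lia.
(* The difference [a1 - b1] can be any value from [-b] to [a] and has to be congruent to [p] modulo
   [K]; the inequality provides such a value. *)
have [a [b [Es leab]]] : exists a b, s = a * (K - 1) + b * (K + 1) /\ (p + b) %% K <= a + b.
  case: (ltnP s ((K - 1) * (K - 1))) => hs.
    pose b := (s - (K - 1) * (K - 2))./2.
    have Eb : s = (K - 1) * (K - 2) + 2 * b.
      rewrite mul2n even_halfK ?subnKC // oddB // (negbTE evs) /= oddM.
      by rewrite oddB // oK.
    have EKK : (K - 1) * (K - 1) = (K - 1) * (K - 2) + (K - 1).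
      by rewrite -mulnSr; congr (_ * _); lia.
    have leb : b <= K - 2 by lia.
    exists (K - 2 - b), b; split.
      have -> : K + 1 = (K - 1) + 2 by lia.
      rewrite mulnDr addnA -mulnDl subnK // {1}Eb; lia.
    rewrite subnK // leqNgt; apply/negP=> lt.
    (* In the exceptional class [2 * r] is congruent to 1, impossible for an even number below the
       odd [K]. *)
    have Epb : (p + b) %% K = K - 1 by have := ltn_pmod (p + b) K_gt0; lia.
    have E1 : (p + b + 1) %% K = 0.
      by rewrite -modnDml Epb subnK // modnn.
    have E2 : (K - 1) * (K - 2) = 2 %[mod K].
      have -> : (K - 1) * (K - 2) = (K - 3) * K + 2 by clear -K_gt2; nia.
      by rewrite modnMDl.
    have E3 : 2 * r = 1 %[mod K].
      rewrite -modE; have -> : 2 * p + 2 * r + s = 2 * (p + b) + 2 * r + (K - 1) * (K - 2).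
        by rewrite {1}Eb; clear; lia.
      rewrite -modnDmr E2 modnDmr.
      have -> : 2 * (p + b) + 2 * r + 2 = 2 * (p + b + 1) + 2 * r by clear; lia.
      have E4 : (2 * (p + b + 1)) %% K = 0 by rewrite -modnMmr E1 muln0 mod0n.
      by rewrite -modnDml E4.
    have le2r : 2 * r <= K by move: hs lers; rewrite EKK; clear -K_gt2; lia.
    have ne2r : 2 * r != K by apply: contraTneq oK => <-; rewrite oddM.
    have lt2r : 2 * r < K by rewrite ltn_neqAle ne2r.
    by move: E3; rewrite !modn_small //; clear -K_gt2; lia.
  have ev1 : ~~ odd (K - 1) by rewrite oddB // oK.
  have Em : (s %% (K - 1))./2.*2 = s %% (K - 1).
    apply: even_halfK; move: evs; rewrite {1}(divn_eq s (K - 1)) oddD oddM.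
    by rewrite (negbTE ev1) andbF.
  have ltm : s %% (K - 1) < K - 1 by rewrite ltn_mod; lia.
  have lej : K - 1 <= s %/ (K - 1) by rewrite leq_divRL //; lia.
  have lth : (s %% (K - 1))./2 <= s %/ (K - 1) by lia.
  exists (s %/ (K - 1) - (s %% (K - 1))./2), (s %% (K - 1))./2; split.
    rewrite {1}(divn_eq s (K - 1)) -{1}Em.
    move: (s %/ _) (_./2) lth => x y; clear -K_gt2; nia.
  by rewrite subnK //; have := ltn_pmod (p + (s %% (K - 1))./2) K_gt0; lia.
set u := (p + b) %% K in leab.
have Epb : p + b = (p + b) %/ K * K + u := divn_eq _ _.
move: ((p + b) %/ K) Epb => y Epb; clearbody u.
case: (leqP b u) => lebu.
  move=> {les lers modE}; exists (u - b), 0, (a - (u - b)), b; split.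
    rewrite Es; have -> : a * (K - 1) = (u - b) * (K - 1) + (a - (u - b)) * (K - 1).
      by rewrite -mulnDl; congr (_ * _); lia.
    lia.
  have -> : p + ((u - b) * (K - 1) + 0 * (K + 1)) = (y + (u - b)) * K.
    by rewrite mulnDl -{2}(subnK K_gt0) mulnDr muln1; lia.
  exact: dvdn_mull.
move=> {les lers modE}; exists 0, (b - u), a, u; split.
  rewrite Es; have -> : b * (K + 1) = (b - u) * (K + 1) + u * (K + 1).
    by rewrite -mulnDl; congr (_ * _); lia.
  lia.
have -> : p + (0 * (K - 1) + (b - u) * (K + 1)) = (y + (b - u)) * K.
  rewrite !mulnDl mulnDr muln1; lia.
exact: dvdn_mull.
Qed.

(** As [K] is odd, parity and residue modulo [K] determine one number in every window of length
    [2 * K]. *)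
Lemma odd_class K M c : odd K -> 2 * K <= M ->
  exists q, [/\ q <= M, M < q + 2 * K, odd q & q = c %[mod K]].
Proof.
move=> oK leM; have K_gt0 : 0 < K by case: K oK leM.
pose i := (M + (K - 1) * c) %% K.
have lti : i < K by rewrite ltn_mod.
have E : M - i = c %[mod K].
  apply/eqP; rewrite -(eqn_modDr i) subnK; last by lia.
  rewrite modnDmr addnCA -mulSn (_ : (K - 1).+1 = K); last by lia.
  by rewrite addnC mulnC modnMDl.
have leiM : i + K <= M by clearbody i; clear E; lia.
have leKMi : K <= M - i by rewrite leq_subRL ?(leq_trans _ leiM) ?leq_addr.
clearbody i; case: (boolP (odd (M - i))) => o.
  by exists (M - i); split=> //; clear E; lia.
exists (M - i - K); split.
- by clear E; lia.
- by clear E; lia.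
- by rewrite oddB // oK (negbTE o).
by rewrite -E -[in RHS](subnK leKMi) modnDr.
Qed.

(** Greedy choice: each part is as large as possible while leaving 1 for each later part. *)
Lemma odd_gaps n m V : odd V -> odd n = odd m -> n <= m <= n * V ->
  exists gs, [/\ size gs = n, sumn gs = m & {in gs, forall g, odd g && (g <= V)}].
Proof.
move=> oV; elim: n m => [|n IHn] m onm /andP[lem lemV].
  by exists [::]; split=> //=; lia.
pose g := minn V (m - n).
have og : odd g.
  rewrite /g /minn; case: ifP => // _; rewrite oddB; last by lia.
  by move: onm => /= <-; case: (odd n).
have leg : g <= m - n by apply: geq_minr.
have [||gs [sz sm gsP]] := IHn (m - g).
- by rewrite oddB ?og; [move: onm => /=; case: (odd n) (odd m) => [] [] | lia].
- apply/andP; split; first by lia.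
  rewrite /g /minn; case: ltnP => h; first by rewrite mulSn in lemV; lia.
  by have := leq_pmulr n (odd_gt0 oV); lia.
exists (g :: gs); split; rewrite /= ?sz ?sm ?subnKC //; first by lia.
move=> x; rewrite inE => /orP[/eqP ->|/gsP //].
by rewrite og geq_minl.
Qed.

Lemma anchored_along (T : finType) K (G : {set {set T}}) g w i :
  walk (adj G) g w -> i <= g -> anchored K G (w 0) -> anchored K G (w i).
Proof.
move=> wR leig an.
have := @anchored_walk T K G i (fun j => w (i - j)); rewrite subn0 subnn; apply=> //.
apply: walk_rev; first exact: adj_sym.
by move=> j ltj; apply: wR; lia.
Qed.

(** * Walks whose coincidences are reflections about a middle edge *)

Section Reflected.

Variables (T : finType) (K : nat).
Hypothesis K_gt2 : 2 < K.
Hypothesis oddK : odd K.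
Let K_gt1 : 1 < K := ltnW K_gt2.

Local Notation boot := (bootstrap (cycle_graph K.+1)).

Variables (G : {set {set T}}) (w : nat -> T) (l p : nat).
Hypothesis sG : simple_graph G.
Hypothesis wR : walk (adj G) l w.
Hypothesis wrefl : forall i j, i < j <= l -> w i = w j -> i + j = p.*2.+1.
Hypothesis an : anchored K G (w 0).

Let centre c := c = p \/ c = p.+1.

Lemma refl_ends_neq : p < l -> w p <> w p.+1.
Proof. by move=> ltpl E; have := adj_neq sG (wR ltpl); rewrite E eqxx. Qed.

(** A reflected pair has one member at [p] or below and one at [p.+1] or above. On one side only [p]
    and [p.+1] themselves remain, and these carry adjacent vertices. *)
Lemma one_sided_inj a b : a <= b <= l -> b <= p.+1 \/ p <= a ->
  inj_upto (b - a) (fun i => w (a + i)).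
Proof.
move=> /andP[leab lebl] side.
have main i j : i < j -> j <= b - a -> w (a + i) <> w (a + j).
  move=> ltij lej E.
  have h : a + i < a + j <= l by lia.
  have S := wrefl h E.
  have [e1 e2] : a + i = p /\ a + j = p.+1 by lia.
  by move: E; rewrite e1 e2; apply: refl_ends_neq; lia.
move=> i j lei lej E; case: (ltngtP i j) => // h.
  by case: (main i j h lej).
by case: (main j i h lei).
Qed.

Lemma one_sided_adj t a b s : a < b <= l -> b <= p.+1 \/ p <= a ->
  odd (b - a) -> b - a + s = K ^ t -> semigroup K s -> path_time K <= t ->
  adj (boot G t) (w a) (w b).
Proof.
move=> /andP[ltab lebl] side o E S let_.
have := @path_adj T K K_gt1 G t (fun i => w (a + i)) (b - a) s.
rewrite addn0 subnKC ?(ltnW ltab) //; apply => //.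
- by apply: (anchored_along wR) => //; lia.
- by move=> i lti; rewrite addnS; apply: wR; lia.
- by apply: one_sided_inj => //; lia.
- by lia.
Qed.

(** Two positions of the class add up to [p.*2] or [p.*2 + 2] modulo [K]. *)
Lemma class_not_refl c q x y : centre c -> q = c %[mod K] ->
  q + K * x + (q + K * y) <> p.*2.+1.
Proof.
move=> cc qc E.
have : (c + c == p.*2.+1 %[mod K]).
  have h z : q + K * z = c %[mod K] by rewrite addnC mulnC modnMDl.
  by rewrite -E -(modnDm (q + K * x)) !h modnDm.
have small : (0 == 1 %[mod K]) = false by rewrite !modn_small; lia.
case: cc => ->.
  have -> : p.*2.+1 = p + p + 1 by lia.
  by rewrite -[X in X == _ %[mod K]]addn0 eqn_modDl small.
have -> : p.+1 + p.+1 = p.*2.+1 + 1 by lia.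
by rewrite -[X in _ == X %[mod K]]addn0 eqn_modDl eq_sym small.
Qed.

(** The class has no position strictly between [c - K] and [c], so the segment of [K] edges stays on
    one side of the middle. *)
Lemma class_jump c q z : centre c -> q = c %[mod K] -> q + K * z.+1 <= l ->
  adj (boot G 1) (w (q + K * z)) (w (q + K * z.+1)).
Proof.
move=> cc qc lel; set a := q + K * z.
have Ea : q + K * z.+1 = a + K by rewrite mulnS /a; lia.
rewrite Ea in lel *.
have ac : a = c %[mod K] by rewrite /a addnC mulnC modnMDl.
have side : a + K <= p.+1 \/ p <= a.
  case: (leqP p a) => [|ltap]; [by right | left].
  have ltac : a < c by case: cc; lia.
  move/eqP: ac; rewrite eq_sym eqn_mod_dvd; last exact: ltnW.
  by move/dvdn_leq; rewrite subn_gt0 ltac => /(_ isT); case: cc; lia.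
have lea : a <= a + K <= l by rewrite leq_addr.
have := @jump_adj T K K_gt1 G K (fun i => w (a + i)) 0 sG; rewrite addn0 add0n; apply=> //.
  by move=> i lti; rewrite addnS; apply: wR; lia.
by have := one_sided_inj lea side; rewrite addKn.
Qed.

(* The positions congruent to p or to p + 1 modulo K, the two middle positions,
   never coincide, and consecutive ones are adjacent after one step; so they
   form a path of the first-step graph that crosses the odd cycle. *)
Lemma class_adj t c q x g s : centre c -> q = c %[mod K] -> q + K * (x + g) <= l ->
  odd g -> g + s = K ^ t -> semigroup K s -> path_time K <= t ->
  adj (boot G t.+1) (w (q + K * x)) (w (q + K * (x + g))).
Proof.
move=> cc qc lel og E S let_; rewrite -[t.+1]add1n -boot_add.
have le z : z <= g -> q + K * (x + z) <= l.
  by move=> lez; apply: leq_trans lel; rewrite leq_add2l leq_mul2l leq_add2l lez orbT.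
have := @path_adj T K K_gt1 (boot G 1) t (fun z => w (q + K * (x + z))) g s.
rewrite addn0; apply => //.
- exact: simple_boot.
- apply: (@anchored_sub T K G); first by move=> a b; apply: (@adj_boot_leq _ _ G 0).
  by apply: (anchored_along wR) => //; have := le 0 (leq0n _); rewrite addn0.
- by move=> z ltz; rewrite addnS; apply: (class_jump cc qc); rewrite -addnS; apply: le.
- have main i j : i < j -> j <= g -> w (q + K * (x + i)) <> w (q + K * (x + j)).
    move=> ltij lej Ew.
    have h : q + K * (x + i) < q + K * (x + j) <= l.
      by rewrite le // andbT ltn_add2l ltn_pmul2l ?ltn_add2l //; lia.
    exact: (class_not_refl cc qc (wrefl h Ew)).
  move=> i j lei lej Ew; case: (ltngtP i j) => // h.
    by case: (main i j h lej).
  by case: (main j i h lei).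
- by case: (g) og.
Qed.

(** The last step runs through 0, through [K - 1] positions of one class, and to [l]. Positions of
    the class never coincide; one of them and [l] add up to more than [p.*2.+1]; and 0 could only
    meet the position [p.*2.+1], which the class positions avoid. *)
Lemma assemble t c q gs : centre c -> q = c %[mod K] -> 0 < q ->
  size gs = K - 2 -> q + K * sumn gs < l -> p.*2.+1 <= l -> w 0 <> w l ->
  {in gs, forall g, odd g /\ exists2 s, g + s = K ^ t & semigroup K s} ->
  (forall z, z <= sumn gs -> q + K * z <> p.*2.+1) ->
  adj (boot G t.+1) (w 0) (w q) ->
  adj (boot G t.+1) (w (q + K * sumn gs)) (w l) ->
  path_time K <= t ->
  adj (boot G t.+2) (w 0) (w l).
Proof.
move=> cc qc q_gt0 sz ltl lepl nwl gsP nrefl adj1 adj2 let_.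
have K_gt0 : 0 < K by lia.
pose Q b := if b is b'.+1 then (if b' < K - 1 then q + K * sumn (take b' gs) else l) else 0.
have QE b : b < K - 1 -> Q b.+1 = q + K * sumn (take b gs) by rewrite /= => ->.
have QK : Q K = l by rewrite /Q; case: K K_gt0 => // K' _; rewrite subn1 ltnn.
have les b : sumn (take b gs) <= sumn gs.
  by rewrite -{2}(cat_take_drop b gs) sumn_cat leq_addr.
have gsgt g : g \in gs -> 0 < g by move/gsP=> [/odd_gt0].
have mono1 b : b < K -> Q b < Q b.+1.
  case: b => [|b] ltb; first by rewrite QE ?take0 ?muln0 ?addn0 //; lia.
  case: (ltnP b.+1 (K - 1)) => h; last first.
    have -> : b.+2 = K by lia.
    rewrite QK QE; last lia.
    apply: leq_ltn_trans ltl.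
    by rewrite leq_add2l leq_mul2l les orbT.
  rewrite !QE //; last lia.
  have hb : b < size gs by rewrite sz; lia.
  rewrite ltn_add2l ltn_pmul2l // sumn_takeS //.
  by rewrite -[X in X < _]addn0 ltn_add2l; apply: gsgt; apply: mem_nth.
have mono a b : a < b -> b <= K -> Q a < Q b.
  elim: b => // b IHb; rewrite ltnS leq_eqVlt => /orP[/eqP ->|ltab] leb; first exact: mono1.
  by apply: ltn_trans (IHb ltab (ltnW leb)) (mono1 _ leb).
have Qle b : b <= K -> Q b <= l.
  move=> leb; rewrite -QK; case: (ltngtP b K) leb => // [h _|-> //].
  exact: ltnW (mono _ _ h _).
apply/adj_bootS => //; right; exists (w \o Q); split; rewrite /= ?QK //.
- have main a b : a < b -> b <= K -> w (Q a) <> w (Q b).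
    move=> ltab leb E.
    have h : Q a < Q b <= l by rewrite mono // Qle.
    have S := wrefl h E.
    case: a ltab h S E => [|a] ltab h S E.
      case: (ltngtP b K) leb => // [ltbK _|EbK _].
        case: b ltab ltbK h S E => // b _ ltbK h S E.
        rewrite QE in S; last lia.
        by apply: (nrefl (sumn (take b gs))) => //; rewrite -S.
      by rewrite EbK QK in E.
    have Qa : 0 < Q a.+1 by rewrite QE; lia.
    case: (ltngtP b K) leb => // [ltbK _|EbK _]; last by rewrite EbK QK in S; lia.
    case: b ltab ltbK h S E => // b ltab ltbK h S E.
    by rewrite !QE in S; [exact: (class_not_refl cc qc S) | lia | lia].
  move=> a b lea leb E; case: (ltngtP a b) => // h.
    by case: (main a b h leb).
  by case: (main b a h lea).
move=> b ltb; change (adj (boot G t.+1) (w (Q b)) (w (Q b.+1))).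
case: b ltb => [|b] ltb.
  by rewrite QE ?take0 ?muln0 ?addn0 //; lia.
case: (ltnP b.+1 (K - 1)) => h; last first.
  have Eb : b.+2 = K by lia.
  have Es : b = size gs by rewrite sz; lia.
  by rewrite Eb QK QE; [rewrite Es take_size | lia].
have hb : b < size gs by rewrite sz; lia.
rewrite !QE // ?sumn_takeS //; last lia.
have [og [s E S]] := gsP _ (mem_nth 0 hb).
apply: (class_adj cc qc _ og E S let_).
by rewrite -sumn_takeS //; apply: leq_trans (ltnW ltl); rewrite leq_add2l leq_mul2l les orbT.
Qed.

End Reflected.

(** * Choosing the lengths of the pieces *)

Lemma deficit_small (E K KK F Y V A s : nat) :
  [/\ 9 * KK <= Y, 27 * K <= Y, 81 <= Y, E <= KK & F <= Y] -> 40 * Y <= V ->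
  3 * V <= A -> s < 2 * E + 4 * K + F -> 2 * s + 2 < A.
Proof. by case=> *; lia. Qed.

(** Linear arithmetic for [slack_adj], with products as variables: [q], [m] and [L] are the lengths
    of the first, middle and last part. Each outer part nearly reaches the centre [c] or nearly has
    the maximal length [A - E], which bounds the middle part. *)
Lemma middle_bound (E K Q F Y V A B s l q L m c b : nat) :
  l = q + L + m -> l = c + b ->
  c < q + 2 * K \/ A - E < q + 2 * K -> b < L + 2 * K + Q \/ A - E < L + 2 * K ->
  2 * E + 4 * K + F <= s ->
  [/\ 9 * Q <= Y, 27 * K <= Y, 81 <= Y, E <= Q & F <= Y] /\ 40 * Y <= V ->
  3 * V <= A -> 3 * A <= B -> l + s = B -> 2 * b <= B + 1 -> 2 * c <= l + 1 ->
  m <= B - 2 * A - F.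
Proof.
move=> El Elbc hq hL les [[h1 h2 h3 h4 h5] hV] hA hB EB hb hc.
have leE : E <= A by lia.
by case: hq => hq; case: hL => hL; lia.
Qed.

Section ReflectedArith.

Variables (T : finType) (K : nat).
Hypothesis K_gt2 : 2 < K.
Hypothesis oddK : odd K.

Local Notation boot := (bootstrap (cycle_graph K.+1)).

Variables (G : {set {set T}}) (w : nat -> T) (l p t s : nat).
Hypothesis sG : simple_graph G.
Hypothesis wR : walk (adj G) l w.
Hypothesis wrefl : forall i j, i < j <= l -> w i = w j -> i + j = p.*2.+1.
Hypothesis an : anchored K G (w 0).
Hypothesis oddl : odd l.
Hypothesis lepl : p.*2.+1 <= l.
Hypothesis nwl : w 0 <> w l.
Hypothesis Els : l + s = K ^ t.+2.
Let E := (K - 1) * (K - 2).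
Hypothesis leEs : E <= s.
Hypothesis leEls : E + (l - p.*2.+1) <= s + 2.
Hypothesis let_ : path_time K <= t.

Let K_gt1 : 1 < K := ltnW K_gt2.
Let K_gt0 : 0 < K := ltnW K_gt1.
Let V := K ^ t.
Let A := K * V.
Let B := K * A.
Let Y := K ^ 4.

Lemma power_bounds :
  [/\ 40 * Y <= V, 3 * V <= A, 3 * A <= B, K * ((K - 2) * V) + 2 * A = B & l + s = B].
Proof.
split.
- rewrite /Y /V; apply: (@leq_trans (K ^ 4 * K ^ 4)).
    rewrite mulnC leq_mul2l; apply/orP; right.
    by apply: (@leq_trans (3 ^ 4)); rewrite // leq_exp2r.
  rewrite -expnD leq_pexp2l //.
  apply: leq_trans let_; apply: (@leq_trans (2 ^ 4)) => //.
  by rewrite leq_pexp2l //; lia.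
- by rewrite leq_mul2r K_gt2 orbT.
- by rewrite leq_mul2r K_gt2 orbT.
- by rewrite mulnCA -/A -mulnDl subnK // ltnW.
- by rewrite Els !expnS.
Qed.

Lemma poly_bounds : [/\ 9 * (K * K) <= Y, 27 * K <= Y, 81 <= Y, E <= K * K & K * (K - 2) * E <= Y].
Proof.
have EY : Y = K * K * (K * K) by rewrite /Y !expnS expn0 muln1 !mulnA.
have K9 : 9 <= K * K by rewrite (@leq_mul 3 3).
have leE : E <= K * K by rewrite leq_mul // leq_subr.
rewrite EY; split=> //.
- by rewrite leq_mul2r K9 orbT.
- apply: (@leq_trans (9 * (K * K))); last by rewrite leq_mul2r K9 orbT.
  by rewrite -[27]/(9 * 3) -mulnA leq_mul2l leq_mul2r K_gt2 orbT.
- by rewrite (@leq_mul 9 9).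
- by rewrite leq_mul // leq_mul2l leq_subr orbT.
Qed.

Lemma odd_powers : [/\ odd V, odd A, odd B, ~~ odd s & ~~ odd E].
Proof.
have oV : odd V by rewrite oddX oddK orbT.
have oA : odd A by rewrite oddM oddK.
have oB : odd B by rewrite oddM oddK.
split=> //; last by rewrite oddM oddB // oddK.
have [_ _ _ _ EB] := power_bounds.
by move: oB; rewrite -EB oddD oddl; case: (odd s).
Qed.

(* Near the extremal length: all middle gaps are full, and the deficit s is
   shared by the two extreme pieces so that the middle points fall in the class
   of p + 1. *)
Lemma tight_adj : s < 2 * E + 4 * K + K * (K - 2) * E -> adj (boot G t.+2) (w 0) (w l).
Proof.
move=> lts.
have [hV hA hB hV2 EB] := power_bounds.
have bnd : 2 * s + 2 < A := deficit_small poly_bounds hV hA lts.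
have [oV oA oB evs evE] := odd_powers.
(* The walk is longer by [2 * r] behind its middle edge than before it. *)
pose r := (l - p.*2.+1)./2.
have Er : l = p.*2.+1 + 2 * r.
  rewrite mul2n even_halfK ?subnKC // oddB // oddl /= odd_double //.
have modE : 2 * p.+1 + 2 * r + s = 1 %[mod K].
  have -> : 2 * p.+1 + 2 * r + s = A * K + 1 by rewrite [A * K]mulnC -/B -EB Er; lia.
  by rewrite modnMDl.
have leEr : E + 2 * r <= s + 2 by move: leEls; rewrite {1}Er addKn.
have [a1 [b1 [a2 [b2 [Es dv]]]]] := split_class oddK K_gt2 evs leEs leEr modE.
set sL := a1 * _ + _ in Es dv; set sR := a2 * _ + _ in Es.
have SL : semigroup K sL by exists a1, b1.
have SR : semigroup K sR by exists a2, b2.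
have evn x y : ~~ odd (x * (K - 1) + y * (K + 1)).
  by rewrite oddD !oddM oddD oddB // oddK !andbF.
have evL := evn a1 b1; have evR := evn a2 b2; rewrite -/sL in evL; rewrite -/sR in evR.
clearbody sL sR.
have sumE : sumn (nseq (K - 2) V) = (K - 2) * V by rewrite sumn_nseq mulnC.
have EV2 : K * ((K - 2) * V) = B - 2 * A by rewrite -hV2 addnK.
(* [K] divides [A] and, by the choice of the split, [p.+1 + sL]. *)
have qc : A - sL = p.+1 %[mod K].
  apply/eqP; rewrite -(eqn_modDr sL) subnK; last by clear -bnd Es; lia.
  by move: dv; rewrite /dvdn => /eqP->; rewrite modnMr.

have sLs : sL <= s by rewrite Es leq_addr.
apply: (@assemble T K K_gt2 oddK G w l p sG wR wrefl an t p.+1 (A - sL) (nseq (K - 2) V)) => //.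
- by right.
- by clear -bnd sLs; lia.
- by rewrite size_nseq.
- by rewrite sumE; move: EV2; move: (K * _) => X EV2; clear -bnd sLs EV2 EB hB; lia.
- move=> g; rewrite mem_nseq => /andP[_ /eqP->]; split=> //.
  by exists 0; rewrite ?addn0 //; exists 0, 0.
(* All middle points lie before [p.*2.+1], since [s] and [r] are small compared with [A]. *)
- rewrite sumE => z lez.
  have : K * z <= K * ((K - 2) * V) by rewrite leq_mul2l lez orbT.
  move: EV2; move: (K * _) (K * z) => X x EV2 lex.
  by clear -bnd sLs EV2 EB hB lex Er leEr; lia.
- apply: (@one_sided_adj T K K_gt2 oddK G w l p sG wR wrefl an t.+1 0 (A - sL) sL) => //.
  + by clear -bnd sLs EB hB; lia.
  + by left; clear -bnd sLs EB hB Er leEr; lia.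
  + by rewrite subn0 oddB; [rewrite oA (negbTE evL) | clear -bnd sLs; lia].
  + by rewrite subn0 expnS -/V -/A subnK //; clear -bnd sLs; lia.
  + exact: leqW.
- rewrite sumE; have Ela : l - (A - sL + K * ((K - 2) * V)) = A - sR.
    by move: EV2; move: (K * _) => X EV2; clear -bnd sLs EV2 EB hB Es; lia.
  apply: (@one_sided_adj T K K_gt2 oddK G w l p sG wR wrefl an t.+1 _ l sR) => //.
  + by move: EV2; move: (K * _) => X EV2; clear -bnd sLs EV2 EB hB Es; lia.
  + by right; move: EV2; move: (K * _) => X EV2; clear -bnd sLs EV2 EB hB Es Er leEr; lia.
  + by rewrite Ela oddB; [rewrite oA (negbTE evR) | clear -bnd sLs Es; lia].
  + by rewrite Ela expnS -/V -/A subnK //; clear -bnd sLs Es; lia.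
  + exact: leqW.
Qed.

(** A large total deficit leaves each long piece a deficit of at least [E], which [semigroup_odd]
    accepts; only parities, residues modulo [K] and sizes have to be arranged. *)
Lemma slack_adj : K ^ 5 < l -> 2 * E + 4 * K + K * (K - 2) * E <= s ->
  adj (boot G t.+2) (w 0) (w l).
Proof.
move=> ltKl les.
have [hV hA hB hV2 EB] := power_bounds.
have [h1 h2 h3 h4 h5] := poly_bounds.
have [oV oA oB evs evE] := odd_powers.
(* The centre is chosen so that [p.*2.+1], the mirror position of 0, is outside its class. *)
have [c [cc nrefl]] : exists c, (c = p \/ c = p.+1) /\
    forall q z, q = c %[mod K] -> q + K * z <> p.*2.+1.
  have red c' q z : q = c' %[mod K] -> q + K * z = p.*2.+1 -> c' = p.*2.+1 %[mod K].
    by move=> <- <-; rewrite addnC mulnC modnMDl.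
  have small : (0 == 1 %[mod K]) = false by rewrite !modn_small.
  have dbl : p.*2.+1 = p.+1 + p by lia.
  have dbl' : p.*2.+1 = p + p.+1 by lia.
  case: (boolP (K %| p)) => dv.
    exists p; split=> [|q z qc /(red _ _ _ qc) /eqP]; first by left.
    rewrite dbl' -{1}[p]addn0 eqn_modDl -addn1 -[0]/(0 + 0).
    have /eqP p0 : p == 0 %[mod K] by rewrite mod0n; apply: dv.
    by rewrite -(modnDml p) p0 modnDml add0n small.
  exists p.+1; split=> [|q z qc /(red _ _ _ qc) /eqP]; first by right.
  rewrite dbl -{1}[p.+1]addn0 eqn_modDl mod0n eq_sym.
  by move=> h; case/negP: dv.
pose U := A - E.
have bV : 2 * c <= l + 1 by clear -cc lepl; lia.
have lecl : c <= l by clear -cc lepl bV ltKl; lia.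
pose b := l - c.
have Elbc : l = c + b by rewrite subnKC.
have hb2 : 2 * b <= B + 1.
  have : 2 <= E by rewrite (@leq_mul 2 1) //; clear -K_gt2; lia.
  by move=> E2; clear -cc leEls EB Elbc E2 lepl; lia.
have K5 : 3 * Y <= K ^ 5 by rewrite [K ^ 5]expnS leq_mul2r K_gt2 orbT.
have KK9 : 3 * K <= K * K by rewrite leq_mul2r K_gt2 orbT.
have hbK : K * K + 2 * K <= b by clear -Elbc bV K5 ltKl h1 h2 h3 KK9; lia.
have UK : 2 * K <= U by rewrite /U; clear -hA hV h2 h4 h1 h3; lia.
(* The first piece ends in the class of [c], and not past [c] unless [c] is below [2 * K]. *)
have [q [leqM ltqM oq qc]] : exists q, [/\ q <= maxn (minn c U) (2 * K),
    maxn (minn c U) (2 * K) < q + 2 * K, odd q & q = c %[mod K]].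
  by apply: odd_class => //; apply: leq_maxr.
(* The last piece starts in the same class. [K * K] positions are kept back for the [K - 2] middle
   gaps and for a first piece that passes [c]. *)
have [L2 [leL2 ltL2 oL2 L2c]] : exists L, [/\ L <= minn (b - K * K) U,
    minn (b - K * K) U < L + 2 * K, odd L & L = b %[mod K]].
  by apply: odd_class => //; rewrite leq_min UK andbT leq_subRL; clear -hbK; lia.
have fqM : q <= c \/ q <= 2 * K.
  by move: leqM; rewrite leq_max leq_min => /orP[/andP[]|]; [left | right].
have fqU : q <= U.
  by apply: leq_trans leqM _; rewrite geq_max UK geq_minr.
have fqm : c < q + 2 * K \/ U < q + 2 * K.
  by move: ltqM; rewrite gtn_max gtn_min => /andP[/orP[] h _]; [left | right].
have fLU : L2 <= U by move: leL2; rewrite leq_min => /andP[].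
have fLb : L2 + K * K <= b.
  move: leL2; rewrite leq_min => /andP[h _]; move: (K * K) h hbK => Q h hbK; clear -h hbK; lia.
have fLm : b < L2 + 2 * K + K * K \/ U < L2 + 2 * K.
  move: ltL2; rewrite gtn_min => /orP[] h; [left | by right].
  by move: (K * K) h => Q h; clear -h; lia.
clear leqM ltqM leL2 ltL2.
have leqL : q + L2 <= l by case: fqM => h; clear -h fLb Elbc hbK KK9; lia.
have dvm : K %| l - (q + L2).
  by rewrite -eqn_mod_dvd // Elbc -modnDm -qc -L2c modnDm.
pose m := (l - (q + L2)) %/ K.
have Em : l = q + L2 + K * m by rewrite /m mulnC divnK // subnKC.
have om : odd m.
  by move: oddl; rewrite Em !oddD oq oL2 oddM oddK.
have lem : K * (K - 2) <= K * m.
  rewrite mulnBr; move: (K * m) (K * K) Em fLb hbK => X Q Em fLb hbK.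
  by case: fqM => h; clear -Em h fLb Elbc hbK; lia.
have gem : K * m <= K * ((K - 2) * (V - E)).
  have -> : K * ((K - 2) * (V - E)) = (B - 2 * A) - K * (K - 2) * E.
    by rewrite mulnBr mulnBr -hV2 addnK -[K * (K - 2) * E]mulnA.
  exact: (middle_bound Em Elbc fqm fLm les (conj poly_bounds hV) hA hB EB hb2 bV).
have [gs [szg sumg gsP]] : exists gs, [/\ size gs = K - 2, sumn gs = m &
    {in gs, forall g, odd g && (g <= V - E)}].
  apply: odd_gaps.
  - by rewrite oddB; [rewrite oV (negbTE evE) | clear -hV h4 h1; lia].
  - by rewrite oddB // oddK om.
  - by rewrite -(leq_pmul2l K_gt0) lem -(leq_pmul2l K_gt0) gem.
have semi x P : odd x -> odd P -> x + E <= P -> semigroup K (P - x).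
  move=> ox oP lex; apply: semigroup_odd => //; last by rewrite -/E; clear -lex; lia.
  by rewrite oddB; [rewrite ox oP | clear -lex; lia].
have EA : K ^ t.+1 = A by rewrite expnS.
have leEV : E <= V by clear -hV h4 h1; lia.
have leEA : E <= A by clear -hV hA leEV; lia.
have pathK : path_time K <= t.+1 := leqW let_.
apply: (@assemble T K K_gt2 oddK G w l p sG wR wrefl an t c q gs) => //.
- by case: (q) oq.
- by rewrite sumg Em; case: (L2) oL2 => // L _; clear; lia.
- move=> g /gsP/andP[og leg]; split=> //; exists (V - g); last first.
    by apply: semi => //; clear -leg leEV; lia.
  by rewrite subnKC //; clear -leg leEV; lia.
- by move=> z _; apply: nrefl.
(* If the centre is close to the start, the first piece may pass it, but then its length is
   bounded. *)
- case: (leqP (2 * K) c) => hc.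
    apply: (@one_sided_adj T K K_gt2 oddK G w l p sG wR wrefl an t.+1 0 q (A - q)) => //.
    + by apply/andP; split; [case: (q) oq | clear -leqL; lia].
    + by left; case: fqM => h; case: cc => E'; clear -h hc E'; lia.
    + by rewrite subn0.
    + by rewrite subn0 EA subnKC //; rewrite /U in fqU; clear -fqU leEA; lia.
    + by apply: semi => //; rewrite /U in fqU; clear -fqU leEA; lia.
  have q0 : 0 < q by case: (q) oq.
  have leq2K : q <= 2 * K by case: fqM => h; clear -h hc; lia.
  have := @anchored_adj T K K_gt1 G q w sG an.
  have wq : walk (adj G) q w by move=> i lti; apply: wR; clear -lti leqL; lia.
  have nq : w 0 <> w q.
    have lql : 0 < q <= l by rewrite q0; clear -leqL; lia.
    by move/(wrefl lql) => Eq; apply: (nrefl q 0 qc); rewrite muln0 addn0.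
  move=> /(_ wq nq (fun _ => oq)); apply: adj_boot_leq; apply: leq_trans pathK.
  rewrite leq_exp2l // leq_add2r leq_add2l; clear -leq2K h2 K5; lia.
- have El : l - (q + K * sumn gs) = L2 by rewrite sumg {1}Em; clear; lia.
  apply: (@one_sided_adj T K K_gt2 oddK G w l p sG wR wrefl an t.+1 _ l (A - L2)) => //.
  + rewrite sumg leqnn andbT [X in _ < X]Em; case: (L2) oL2 => // L _; clear; lia.
  + by right; rewrite sumg; clear -Em fLb Elbc cc hbK; lia.
  + by rewrite El.
  + by rewrite El EA subnKC //; rewrite /U in fLU; clear -fLU leEA; lia.
  + by apply: semi => //; rewrite /U in fLU; clear -fLU leEA; lia.
Qed.

Theorem reflected_adj : adj (boot G t.+2) (w 0) (w l).
Proof.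
case: (leqP l (K ^ 5)) => lel.
  have := anchored_adj K_gt1 sG an wR nwl (fun _ => oddl).
  apply: adj_boot_leq; apply: leq_trans (leq_trans let_ _); last by lia.
  by rewrite leq_exp2l // leq_add2r leq_add2l; apply: leq_trans lel _; apply: leq_addr.
case: (leqP (2 * E + 4 * K + K * (K - 2) * E) s) => les; first exact: slack_adj.
exact: tight_adj.
Qed.

End ReflectedArith.

(** * Upper bounds *)

Lemma connect_reach (T : finType) (R : rel T) x y :
  connect R x y -> exists g, reach R g x y.
Proof.
case/connectP=> s /(pathP x) sR ->; exists (size s), (nth x (x :: s)).
by split=> //; rewrite -last_nth.
Qed.

Lemma reach_connect (T : finType) (R : rel T) g x y : reach R g x y -> connect R x y.
Proof.
case=> v [vR <- <-]; elim: g vR => [|g IHg] vR; first exact: connect0.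
apply: connect_trans (IHg _) (connect1 (vR g _)) => // i lti.
by apply: vR; apply: ltnW.
Qed.

Section Upper.

Variables (T : finType) (K : nat).
Hypothesis K_gt1 : 1 < K.

Local Notation boot := (bootstrap (cycle_graph K.+1)).
Implicit Types G H : {set {set T}}.

(** Every added edge stands for [K] older ones, which preserves oddness when [K] is odd. *)
Lemma boot_reach G i x y : simple_graph G -> adj (boot G i) x y ->
  exists2 g, odd K -> odd g & reach (adj G) g x y.
Proof.
move=> sG; elim: i x y => [|i IHi] x y.
  by move=> xy; exists 1 => //; exists (fun j => if j is 0 then x else y); split=> // -[].
case/(adj_bootS K_gt1 _ _ _ sG) => [/IHi //|[w [<- <- _ wR]]].
have H j : j <= K -> exists2 g, odd K -> odd g = odd j & reach (adj G) g (w 0) (w j).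
  elim: j => [|j IHj] lej; first by exists 0 => //; exists w.
  have [g og rg] := IHj (ltnW lej); have [h oh rh] := IHi _ _ (wR j lej).
  exists (g + h); last exact: reach_cat rg rh.
  by move=> oK; rewrite oddD og // oh // addbT.
by have [g og rg] := H K (leqnn K); exists g => // oK; rewrite og.
Qed.

(** On the way from [w 0] to [y], the first vertex outside the path serves as the attached vertex of
    the anchor. *)
Lemma anchored_reach G w x y : walk (adj G) K w -> inj_upto K w ->
  connect (adj G) x (w 0) -> connect (adj G) (w 0) y ->
  (forall i, i <= K -> y <> w i) -> anchored K G x.
Proof.
move=> wR wI /connect_reach[d r] /connect_reach[g [v [vR v0 vg]]] ny.
pose W z := exists2 i, i <= K & z = w i.
have [z [i0 [lei0 zi0 nz]]] : exists z i0, [/\ i0 <= K, adj G z (w i0) & forall i, i <= K -> z <> w i].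
  have dec z : W z \/ forall i, i <= K -> z <> w i.
    case: (boolP (z \in [seq w i | i <- iota 0 K.+1])) => [|h].
      by case/mapP=> i; rewrite mem_iota => hi ->; left; exists i => //; lia.
    right=> i lei Ez; case/negP: h; apply/mapP; exists i => //.
    by rewrite mem_iota; lia.
  have : forall j, j <= g -> W (v j) \/
      exists z i0, [/\ i0 <= K, adj G z (w i0) & forall i, i <= K -> z <> w i].
    elim=> [|j IHj] lej; first by left; exists 0.
    case: (IHj (ltnW lej)) => [[i lei vj]|]; last by right.
    case: (dec (v j.+1)) => [|nv]; first by left.
    right; exists (v j.+1), i; split=> //.
    by rewrite adj_sym -vj; apply: vR.
  by case/(_ g (leqnn g)) => // -[i lei]; rewrite vg => /ny.
by exists d, w, z, i0.
Qed.

(** A component with at most [K + 1] vertices is finished by [within_stable]; one without a path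
    with [K] edges never changes; in any other component all vertices are anchored. *)
Lemma boot_stabilised G t : simple_graph G -> 2 ^ K.+1 <= t ->
  (forall g v, anchored K G (v 0) -> walk (adj G) g v -> v 0 <> v g ->
     (odd K -> odd g) -> adj (boot G t) (v 0) (v g)) ->
  boot G t = boot G t.+1.
Proof.
move=> sG let_ anchR; apply/eqP; rewrite eqEsubset; apply/andP; split; first exact: boot_sub.
apply: simple_subset; first exact: simple_boot.
move=> x y xy.
pose V := [set z | connect (adj G) x z].
have xV : x \in V by rewrite inE connect0.
have Vstep i a b : a \in V -> adj (boot G i) a b -> b \in V.
  rewrite !inE => xa /(boot_reach sG)[g _ /reach_connect ab].
  exact: connect_trans xa ab.
have Vwalk i g w : w 0 \in V -> walk (adj (boot G i)) g w -> forall j, j <= g -> w j \in V.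
  move=> w0 wR; elim=> // j IHj lej.
  by apply: Vstep (IHj (ltnW lej)) (wR j lej).
case: (leqP #|V| K.+1) => cV.
  pose H := [set e in G | e \subset V].
  have sHG : H \subset G by apply/subsetP=> e; rewrite inE => /andP[].
  have sH : simple_graph H by apply: subset_trans sHG sG.
  have wH : within V H.
    by move=> a b; rewrite /adj inE => /andP[_ /subsetP]; apply; rewrite set21.
  have loc i a b : a \in V -> adj (boot G i) a b -> adj (boot H i) a b.
    elim: i a b => [|i IHi] a b aV ab.
      rewrite /adj inE; apply/andP; split=> //.
      apply/subsetP=> c; rewrite in_set2 => /orP[]/eqP-> //.
      exact: (Vstep 0 a).
    case/(adj_bootS K_gt1 _ _ _ sG): ab => [ab|[w [w0 wK wI wR]]]; apply/adj_bootS => //.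
      by left; apply: IHi.
    right; exists w; split=> // j ltj; apply: IHi (wR j ltj).
    by apply: (Vwalk i K) => //; [rewrite w0 | apply: ltnW].
  have := loc t.+1 x y xV xy.
  have le2 : 2 ^ #|V| <= t by apply: leq_trans let_; rewrite leq_exp2l.
  rewrite -(within_stable K_gt1 sH wH le2).
  exact: (subsetP (boot_mono K_gt1 t sH sG sHG)).
case: (boolP [exists f : {ffun 'I_K.+1 -> T}, [&& f ord0 \in V, injectiveb f &
    [forall i : 'I_K, adj G (f (inord i)) (f (inord i.+1))]]]).
  case/existsP=> f /and3P[f0 /injectiveP fI /forallP fR].
  pose w i := f (inord i).
  have w0 : w 0 = f ord0 by congr (f _); apply: val_inj; rewrite /= inordK.
  have wR : walk (adj G) K w by move=> i lti; apply: (fR (Ordinal lti)).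
  have wI : inj_upto K w.
    by move=> i j lei lej /fI/(congr1 val); rewrite /= !inordK.
  have [z zV nz] : exists2 z, z \in V & forall i, i <= K -> z <> w i.
    have : ~~ (V \subset [set f i | i : 'I_K.+1]).
      apply/negP=> /subset_leq_card; rewrite leqNgt => /negP; apply.
      by apply: leq_ltn_trans (leq_imset_card _ _) _; rewrite card_ord.
    case/subsetPn=> z zV nz; exists z => // i lei E; case/negP: nz.
    by rewrite E; apply: imset_f.
  have an : anchored K G x.
    have x0 : connect (adj G) x (w 0) by move: f0; rewrite w0 inE.
    apply: (anchored_reach wR wI x0 _ nz).
    apply: connect_trans (_ : connect (adj G) x z); last by rewrite inE in zV.
    by case/connect_reach: x0 => d /(reach_rev (adj_sym G))/reach_connect.
  have [g og [v [vR v0 vg]]] := boot_reach sG xy.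
  have := anchR g v; rewrite v0 vg; apply=> //.
  by apply/eqP; apply: adj_neq (simple_boot _ _ sG) xy.
rewrite negb_exists => /forallP nf.
have loc i a b : a \in V -> adj (boot G i) a b -> adj G a b.
  elim: i a b => // i IHi a b aV /(adj_bootS K_gt1 _ _ _ sG)[|[w [w0 wK wI wR]]].
    exact: IHi.
  have wV j : j <= K -> w j \in V by apply: (Vwalk i K) => //; rewrite w0.
  exfalso; have := nf [ffun i : 'I_K.+1 => w i]; rewrite ffunE wV //= => /nandP[].
    case/injectiveP=> c d; rewrite !ffunE => /wI E; apply: val_inj.
    by apply: E; rewrite -ltnS ltn_ord.
  case/forallP=> c; have ltc := ltn_ord c.
  rewrite !ffunE !inordK ?ltnS ?(ltnW ltc) //.
  by apply: IHi; [apply: wV; apply: ltnW | apply: wR].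
by apply: (@adj_boot_leq _ _ G 0) => //; apply: loc xV xy.
Qed.

Lemma running_time_leq G t : boot G t = boot G t.+1 ->
  running_time (cycle_graph K.+1) G <= t.
Proof. by move=> E; rewrite /running_time; case: ex_minnP => m _; apply; apply/eqP. Qed.

Lemma running_time_gt G t u : t <= u -> boot G t <> boot G u ->
  t < running_time (cycle_graph K.+1) G.
Proof.
move=> letu ne; rewrite /running_time; case: ex_minnP => m /eqP E _.
rewrite ltnNge; apply/negP=> lemt; apply: ne.
by rewrite (boot_stable E lemt) (boot_stable E (leq_trans lemt letu)).
Qed.

(** A walk without repetitions has fewer than [#|T|] edges, so its deficit is at least
    [K * (K - 2)], beyond the Frobenius number. *)
Lemma even_upper G t g v : ~~ odd K -> simple_graph G -> path_time K <= t ->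
  #|T| + K * K <= K ^ t + 2 * K + 1 ->
  anchored K G (v 0) -> walk (adj G) g v -> v 0 <> v g -> adj (boot G t) (v 0) (v g).
Proof.
move=> evK sG let_ le_t; elim/ltn_ind: g v => g IHg v an vR nv.
case: (inj_uptoPn g v) => [vI|[i [j [hij E]]]]; last first.
  have [v' [vR' v0' vg']] := reach_short vR hij E.
  by rewrite -v0' -vg'; apply: IHg; rewrite ?v0' ?vg' //; lia.
have ltg := inj_upto_card vI.
have EKK : K * (K - 2) + 2 * K = K * K by rewrite mulnBr [2 * K]mulnC subnK // leq_mul2l K_gt1 orbT.
have leg : g + K * (K - 2) <= K ^ t by lia.
have leg' : g <= K ^ t := leq_trans (leq_addr _ _) leg.
apply: (@path_adj T K K_gt1 G t v g (K ^ t - g)) => //.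
- by case: (g) nv.
- by rewrite (negbTE evK).
- by rewrite subnKC.
- by apply: semigroup_large => //; [rewrite (negbTE evK) | rewrite leq_subRL].
Qed.

End Upper.

(* In a shortest odd walk any two coincidences v i = v j and v i' = v j' are
   nested and concentric: otherwise cutting out both closed subwalks, or
   reversing one of them, or replacing a longer by a shorter connecting piece,
   gives a shorter odd walk. *)
Lemma concentric (T : eqType) (R : rel T) g (v : nat -> T) :
  symmetric R -> walk R g v -> odd g ->
  (exists g', [/\ g' < g, odd g' & reach R g' (v 0) (v g)]) \/
  exists p, forall i j, i < j <= g -> v i = v j -> i + j = p.*2.+1.
Proof.
move=> symR vR og.
have sub a b : a <= b <= g -> reach R (b - a) (v a) (v b) by apply: reach_sub.
have bus a b : a <= b <= g -> reach R (b - a) (v b) (v a).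
  by move=> h; apply: reach_rev symR (sub _ _ h).
have short i j : i < j <= g -> v i = v j -> ~~ odd (j - i) ->
    exists g', [/\ g' < g, odd g' & reach R g' (v 0) (v g)].
  move=> hij E o; exists (g - (j - i)); split; [lia | | exact: reach_short].
  by rewrite oddB ?og ?(negbTE o) //; lia.
have twist i j i' j' : i < j <= g -> i' < j' <= g -> v i = v j -> v i' = v j' ->
    i <= i' -> i + j <> i' + j' ->
    exists g', [/\ g' < g, odd g' & reach R g' (v 0) (v g)].
  move=> hij hij' E E' leii ne.
  case: (boolP (odd (j - i))) => [o|]; last exact: short.
  case: (boolP (odd (j' - i'))) => [o'|]; last exact: short.
  have cut a b c d e f : a + b + c < g -> odd (a + b + c) ->
      reach R a (v 0) d -> reach R b d e -> reach R c e f -> f = v g ->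
      exists g', [/\ g' < g, odd g' & reach R g' (v 0) (v g)].
    move=> lt odd3 r1 r2 r3 <-; exists (a + b + c); split=> //.
    exact: reach_cat (reach_cat r1 r2) r3.
  have start a : a <= g -> reach R a (v 0) (v a) by move=> lea; have := sub 0 a lea; rewrite subn0.
  (* With a common start the two odd closed subwalks differ by an even one, which is cut out. *)
  case: (ltngtP i i') leii => // [ltii _|Eii _]; last first.
    subst i'; case: (ltngtP j j') => [h|h|h]; last by case: ne; rewrite h.
      apply: (short j j'); [by lia | by rewrite -E E' | by lia].
    apply: (short j' j); [by lia | by rewrite -E E' | by lia].
  case: (leqP j i') => hji.
    apply: (cut i (i' - j) (g - j') (v i) (v i') (v g)) => //; first by lia.
    - by lia.
    - by apply: start; lia.
    - by rewrite E; apply: sub; lia.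
    - by rewrite E'; apply: sub; lia.
  case: (ltngtP j j') => hjj.
  - apply: (cut i (j - i') (g - j') (v i) (v i') (v g)) => //; first by lia.
    + by lia.
    + by apply: start; lia.
    + by rewrite E; apply: bus; lia.
    + by rewrite E'; apply: sub; lia.
  - case: (ltngtP (i' - i) (j - j')) => hab; last by case: ne; lia.
      apply: (cut j' (i' - i) (g - j) (v j') (v i) (v g)) => //; first by lia.
      + by lia.
      + by apply: start; lia.
      + by rewrite -E'; apply: bus; lia.
      + by rewrite E; apply: sub; lia.
    apply: (cut i (j - j') (g - i') (v i) (v j') (v g)) => //; first by lia.
    + by lia.
    + by apply: start; lia.
    + by rewrite E; apply: bus; lia.
    + by rewrite -E'; apply: sub; lia.
  - by apply: (short i i'); [lia | rewrite E hjj E' | lia].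
case: (inj_uptoPn g v) => [vI|[i [j [hij E]]]].
  by right; exists 0 => i j hij /vI; lia.
case: (boolP (odd (j - i))) => [o|o]; last by left; apply: (short i j).
case: (boolP [forall i' : 'I_g.+1, forall j' : 'I_g.+1,
    (i' < j') && (v i' == v j') ==> (i' + j' == i + j)]) => [/forallP all|].
  right; exists (i + j)./2 => i' j' hij' E'.
  have lti : i' < g.+1 by lia.
  have ltj : j' < g.+1 by lia.
  have /forallP/(_ (Ordinal ltj)) := all (Ordinal lti).
  by rewrite /= E' eqxx andbT (_ : i' < j'); [move/eqP | ]; lia.
rewrite negb_forall => /existsP[i']; rewrite negb_forall => /existsP[j'].
rewrite negb_imply => /andP[/andP[ltij' /eqP E'] /eqP ne]; left.
have hij' : i' < j' <= g by rewrite ltij' -ltnS ltn_ord.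
case: (leqP i i') => h; first by apply: (twist i j i' j') => //; apply: nesym.
by apply: (twist i' j' i j) => //; apply: ltnW.
Qed.

(** Shorter odd walks are handled by induction, so the coincidences may be taken concentric, and
    after reversal the longer half comes second. Counting the vertices of that half gives the
    hypotheses of [reflected_adj]. *)
Lemma odd_upper (T : finType) K (G : {set {set T}}) t g v :
  2 < K -> odd K -> simple_graph G -> path_time K <= t ->
  2 * #|T| + K * K <= K ^ t.+2 + 3 * K + 4 ->
  anchored K G (v 0) -> walk (adj G) g v -> v 0 <> v g -> odd g ->
  adj (bootstrap (cycle_graph K.+1) G t.+2) (v 0) (v g).
Proof.
move=> K_gt2 oddK sG let_ le_t; elim/ltn_ind: g v => g IHg v an vR nv og.
have K_gt1 : 1 < K by apply: ltnW.
case: (concentric (adj_sym G) vR og) => [[g' [ltg' og' [v' [vR' v0' vg']]]]|[p vp]].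
  by rewrite -v0' -vg'; apply: IHg; rewrite ?v0' ?vg'.
have main (u : nat -> T) q : anchored K G (u 0) -> walk (adj G) g u -> u 0 <> u g ->
    (forall i j, i < j <= g -> u i = u j -> i + j = q.*2.+1) -> q.*2.+1 <= g ->
    adj (bootstrap (cycle_graph K.+1) G t.+2) (u 0) (u g).
  move=> {}an uR nu up leq.
  have ltT h f : inj_upto h (fun i => u (f i)) -> h < #|T| by apply: inj_upto_card.
  have uS i : i < g -> u i <> u i.+1.
    by move=> lti E; have := adj_neq sG (uR i lti); rewrite E eqxx.
  have inj h f : (forall i j, i < j -> j <= h -> f i < f j <= g) ->
      (forall i j, i < j -> j <= h -> f i + f j = q.*2.+1 -> u (f i) <> u (f j)) -> h < #|T|.
    move=> fmono fne; apply: (ltT h f) => i j lei lej E; case: (ltngtP i j) => // hij.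
      by case: (fne i j hij lej _ E); apply: up E; apply: fmono.
    by case: (fne j i hij lei _ (esym E)); apply: up (esym E); apply: fmono.
  case: (leqP g 1) => hg.
    have Eg : g = 1 by case: g og hg {IHg vR vp an uR nu up leq ltT uS inj nv} => [|[]].
    rewrite Eg; apply: (@adj_boot_leq _ _ G 0) => //.
    by apply: uR; rewrite Eg.
  have cT : if q.*2.+1 == g then g + 5 <= 2 * #|T| else 2 * g + 2 <= 2 * #|T| + 2 * q.
    case: eqP => [Eq|_].
      (* If 0 mirrors [g], then [u 0] is one more vertex outside the second half, because [u 0] and
         [u g] differ. *)
      have : g - q + 1 < #|T|.
        apply: (inj _ (fun i => if i == 0 then 0 else q + i.-1)) => i j hij lej.
          by case: i hij => [|i] hij; case: j hij lej => //= j hij lej; lia.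
        case: i hij => [|i] hij; case: j hij lej => //= j hij lej.
          by rewrite add0n Eq => ->.
        move=> Es; have [e1 e2] : i = 0 /\ j = 1 by lia.
        by rewrite e1 e2 addn0 addn1; apply: uS; lia.
      lia.
    have : g - q < #|T|.
      apply: (inj _ (fun i => q + i)) => i j hij lej; first by lia.
      move=> Es; have [e1 e2] : i = 0 /\ j = 1 by lia.
      by rewrite e1 e2 addn0 addn1; apply: uS; lia.
    lia.
  have EKK : (K - 1) * (K - 2) + 3 * K = K * K + 2.
    have -> : K = (K - 2) + 2 by lia.
    move: (K - 2) => x; rewrite addnK (_ : x + 2 - 1 = x + 1); [lia | lia].
  have evE : ~~ odd ((K - 1) * (K - 2)) by rewrite oddM oddB ?oddK //; lia.
  have oP : odd (K ^ t.+2) by rewrite oddX oddK orbT.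
  apply: (@reflected_adj T K K_gt2 oddK G u g q t (K ^ t.+2 - g) sG uR up an og leq nu) => //.
  - rewrite subnKC //; move: ((K - 1) * (K - 2)) (K * K) (K ^ t.+2) EKK evE oP le_t cT => E Q P.
    by case: eqP => h; lia.
  - move: ((K - 1) * (K - 2)) (K * K) (K ^ t.+2) EKK evE oP le_t cT => E Q P.
    by case: eqP => h; lia.
  - move: ((K - 1) * (K - 2)) (K * K) (K ^ t.+2) EKK evE oP le_t cT => E Q P.
    by case: eqP => h; lia.
(* Otherwise the reversed walk qualifies, with [g - p.+1] in place of [p]. *)
case: (leqP p.*2.+1 g) => lep; first exact: main vp lep.
rewrite adj_sym; have := main (fun i => v (g - i)) (g - p.+1).
rewrite subn0 subnn; apply.
- exact: anchored_along vR (leqnn g) an.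
- by apply: walk_rev => //; apply: adj_sym.
- by apply: nesym.
- move=> i j hij E; have h : g - j < g - i <= g by lia.
  by have := vp _ _ h (esym E); lia.
- lia.
Qed.

(** * Lower bounds *)

Lemma reach_chain (T : Type) (R : rel T) (P : nat -> nat -> Prop) m w :
  P 0 0 -> (forall i a b, P i a -> P 1 b -> P i.+1 (a + b)) ->
  (forall i, i < m -> exists2 g, P 1 g & reach R g (w i) (w i.+1)) ->
  exists2 g, P m g & reach R g (w 0) (w m).
Proof.
move=> P0 PS H; elim: m H => [|m IHm] H; first by exists 0 => //; exists w.
have [|g Pg rg] := IHm; first by move=> i lti; apply: H; apply: ltnW.
have [h Ph rh] := H m (leqnn _).
by exists (g + h); [apply: PS | apply: reach_cat rg rh].
Qed.

(** All steps but the first are unfolded. An edge of a later level is an older edge or stands for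
    [K] edges of the level before; keeping an older edge changes the count by a multiple of
    [K - 1]. *)
Lemma first_step_reach (T : finType) K (G : {set {set T}}) t x y :
  1 < K -> simple_graph G -> adj (bootstrap (cycle_graph K.+1) G t.+1) x y ->
  exists N, [/\ N <= K ^ t, K - 1 %| K ^ t - N &
    reach (adj (bootstrap (cycle_graph K.+1) G 1)) N x y].
Proof.
move=> K_gt1 sG; elim: t x y => [|t IHt] x y.
  by exists 1; split=> //; exists (fun i => if i is 0 then x else y); split=> // -[].
case/(adj_bootS K_gt1 _ _ _ sG) => [/IHt[N [leN dvN rN]]|[w [<- <- wI wR]]].
  have leK : K ^ t <= K ^ t.+1 by rewrite leq_exp2l.
  exists N; split=> //; first exact: leq_trans leN leK.
  have -> : K ^ t.+1 - N = K ^ t * (K - 1) + (K ^ t - N).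
    by rewrite mulnBr muln1 addnBA // subnK ?expnSr // leq_pmulr //; lia.
  by apply: dvdn_add => //; apply: dvdn_mull.
pose P i a := a <= i * K ^ t /\ K - 1 %| i * K ^ t - a.
have [|||N [leN dvN] rN] := @reach_chain _ (adj (bootstrap (cycle_graph K.+1) G 1)) P K w.
- by [].
- move=> i a b [lea dva] [leb dvb]; rewrite mul1n in leb dvb.
  rewrite /P mulSn; split; first by rewrite addnC leq_add.
  have -> : K ^ t + i * K ^ t - (a + b) = (i * K ^ t - a) + (K ^ t - b).
    by clear -lea leb; move: (i * K ^ t) lea => X lea; lia.
  exact: dvdn_add.
- move=> i lti; have [N [leN dvN rN]] := IHt _ _ (wR i lti).
  by exists N => //; split; rewrite mul1n.
by exists N; rewrite expnS.
Qed.

(** [x], [y], [a] and [b] count the steps by [K], [-K], 1 and -1; the balance is written without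
    subtraction. *)
Lemma count_steps K N (P : nat -> nat) :
  (forall j, j < N -> [\/ P j.+1 = P j + K, P j = P j.+1 + K, P j.+1 = P j + 1 | P j = P j.+1 + 1]) ->
  exists x y a b, x + y + a + b = N /\ P N + K * y + b = P 0 + K * x + a.
Proof.
elim: N => [|N IHN] H; first by exists 0, 0, 0, 0; rewrite !muln0.
have [|x [y [a [b [E1 E2]]]]] := IHN; first by move=> j ltj; apply: H; apply: ltnW.
case: (H N (leqnn _)) => E.
- by exists x.+1, y, a, b; rewrite mulnS; split; lia.
- by exists x, y.+1, a, b; rewrite mulnS; split; lia.
- by exists x, y, a.+1, b; split; lia.
- by exists x, y, a, b.+1; split; lia.
Qed.

Lemma monotone_steps K (P : nat -> nat) : 1 < K ->
  (forall j, j < K -> P j.+1 = P j + 1 \/ P j = P j.+1 + 1) ->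
  (forall j, j.+2 <= K -> P j.+2 <> P j) ->
  (forall j, j <= K -> P j = P 0 + j) \/ (forall j, j <= K -> P 0 = P j + j).
Proof.
move=> K_gt1 step turn.
case: (step 0 (ltnW K_gt1)) => E0; [left | right];
  (elim/ltn_ind=> -[|[|j]] IHj lej; first by rewrite addn0); try by rewrite E0.
all: have e1 := IHj j.+1 (leqnn _) (ltnW lej).
all: have e0 := IHj j (leqnSn _) (ltnW (ltnW lej)).
all: have t := turn j lej; case: (step j.+1 lej); lia.
Qed.

Lemma modn_cancel K A B a b : a < K -> b < K -> K * A + a = K * B + b -> a = b.
Proof.
move=> lta ltb /(congr1 (modn^~ K)) /=.
by rewrite ![K * _]mulnC !modnMDl !modn_small.
Qed.

(** * Graphs given by relations on [nat] *)

Section GraphOf.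

Variable n : nat.

Definition graph_of (r : rel nat) : {set {set 'I_n}} :=
  [set e in pairs 'I_n | [exists x, exists y, (e == [set x; y]) && r x y]].

Lemma simple_graph_of (r : rel nat) : simple_graph (graph_of r).
Proof. by apply/subsetP=> e; rewrite inE => /andP[]. Qed.

Lemma adj_graph_of (r : rel nat) (x y : 'I_n) :
  adj (graph_of r) x y <-> x != y :> nat /\ (r x y \/ r y x).
Proof.
rewrite /adj !inE cards2; split.
  case/andP=> [nxy /existsP[a /existsP[b /andP[/eqP E rab]]]].
  split; first by move: nxy; rewrite -(inj_eq val_inj) /=; case: (_ != _).
  by case: (set2_eq E) => -[-> ->]; [left | right].
case=> nxy rxy; apply/andP; split; first by rewrite -(inj_eq val_inj) /= nxy.
case: rxy => h; apply/existsP; [exists x | exists y]; apply/existsP; [exists y | exists x].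
  by rewrite eqxx.
by rewrite setUC eqxx.
Qed.

Lemma anchored_graph_of K (r : rel nat) : 1 < K -> K.+1 < n ->
  (forall i, i <= K -> r i i.+1) ->
  forall x : 'I_n, x = 0 :> nat -> anchored K (graph_of r) x.
Proof.
move=> K_gt1 ltKn rS x x0.
have n_gt0 : 0 < n by apply: leq_trans ltKn.
pose w (i : nat) : 'I_n := insubd x i.
have wE i : i <= K.+1 -> w i = i :> nat.
  by move=> lei; rewrite /w val_insubd (leq_ltn_trans lei ltKn).
have wR i : i <= K -> adj (graph_of r) (w i) (w i.+1).
  move=> lei; apply/adj_graph_of; rewrite !wE //; last exact: leqW.
  by split; [lia | left; apply: rS].
exists 0, w, (w K.+1), K; split=> //.
- by move=> i lti; apply: wR; apply: ltnW.
- by move=> i j lei lej /(congr1 val); rewrite /= !wE //; apply: leqW.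
- by split=> //; rewrite adj_sym; apply: wR.
- by move=> i lei /(congr1 val); rewrite /= !wE; lia.
- by exists (fun=> x); split=> //; apply: val_inj; rewrite /= wE.
Qed.

End GraphOf.

(** * The path, extremal for odd [k] *)

Definition path_rel (d x y : nat) : bool := (y == x.+1) && (y <= d).

(** [K * V - d] is the Frobenius number [K ^ 2 - 2 * K - 1]. Size permits few unit steps, the
    residue modulo [K] gives [a = b + 1], and divisibility by [K - 1] gives [N = V], which makes [K]
    odd. *)
Lemma even_count K V N d x y a b : 1 < K -> ~~ odd K -> K <= V ->
  d = K * (V + 2 - K) + 1 -> N <= V -> K - 1 %| V - N ->
  x + y + a + b = N -> d + K * y + b = K * x + a -> False.
Proof.
move=> K_gt1 evK leKV Ed leNV dvN EN E.
have EW : K * (V + 2 - K) + K * K = K * V + 2 * K.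
  by rewrite -mulnDr subnK ?mulnDr ?[K * 2]mulnC //; apply: leq_trans leKV (leq_addr _ _).
have EKN : K * x + K * y + K * a + K * b <= K * V by rewrite -!mulnDr leq_mul2l EN leNV orbT.
have EKK : (K - 1) * (K - 1) + 2 * K = K * K + 1.
  by case: K K_gt1 {evK leKV Ed dvN E EW EKN} => // K' _; rewrite subn1 /=; nia.
have leaK : a <= K - 2.
  rewrite leqNgt; apply/negP=> lt.
  have h1 : (K - 1) * (K - 1) <= (K - 1) * a by rewrite leq_mul2l; lia.
  have h2 : (K - 1) * a + a = K * a by rewrite -mulSnr; congr (_ * _); lia.
  by lia.
have leab : a + b <= K - 2.
  rewrite leqNgt; apply/negP=> lt.
  have h1 : K * (K - 1) <= K * (a + b) by rewrite leq_mul2l; lia.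
  have h2 : K * (K - 1) + K = K * K by rewrite -mulnSr; congr (_ * _); lia.
  by rewrite mulnDr in h1; lia.
have Eab : b + 1 = a.
  apply: (@modn_cancel K (V + 2 - K + y) x); rewrite ?mulnDr; lia.
have EW' : V + 2 - K + y = x.
  apply/eqP; rewrite -(eqn_pmul2l (ltnW K_gt1)) mulnDr; apply/eqP; lia.
have EVN : V - N = 0.
  case: (posnP (V - N)) => // VN; have := dvdn_leq VN dvN; lia.
move: evK; have -> : K = (y + b).*2 + 3 by lia.
by rewrite oddD odd_double.
Qed.

Section EvenLower.

Variables (n K t d : nat).
Hypothesis K_gt1 : 1 < K.
Hypothesis evK : ~~ odd K.
Hypothesis leKt : K <= K ^ t.
Hypothesis Ed : d = K * (K ^ t + 2 - K) + 1.
Hypothesis ltdn : d < n.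

Let G := graph_of n (path_rel d).
Let sG : simple_graph G := simple_graph_of n (path_rel d).

Lemma path_first_step x y : adj (bootstrap (cycle_graph K.+1) G 1) x y ->
  [\/ y = x + K :> nat, x = y + K :> nat, y = x + 1 :> nat | x = y + 1 :> nat].
Proof.
have adjG a b : adj G a b -> b = a + 1 :> nat \/ a = b + 1 :> nat.
  by move/adj_graph_of=> [_]; rewrite /path_rel; lia.
case/(adj_bootS K_gt1 _ _ _ sG) => [/adjG|[w [<- <- wI wR]]].
  by case; [constructor 3 | constructor 4].
case: (@monotone_steps K (fun j => w j) K_gt1) => [j ltj|j lej|h|h].
- exact/adjG/wR.
- by move/val_inj/wI; lia.
- by constructor 1; apply: h.
- by constructor 2; apply: h.
Qed.

(** The ends of the path become adjacent in the end by [anchored_adj], but not within [t.+1] steps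
    by [even_count]. *)
Lemma even_lower : t.+1 < running_time (cycle_graph K.+1) G.
Proof.
have n_gt0 : 0 < n by apply: leq_ltn_trans ltdn.
pose w (i : nat) : 'I_n := insubd (Ordinal n_gt0) i.
have wE i : i <= d -> w i = i :> nat.
  by move=> lei; rewrite /w val_insubd (leq_ltn_trans lei ltdn).
have leKd : K.+1 < d.
  by rewrite Ed; apply: (@leq_trans (K * 2 + 1)); [lia | rewrite leq_add2r leq_mul2l; lia].
have w0 : w 0 = 0 :> nat by apply: wE.
have an : anchored K G (w 0).
  apply: anchored_graph_of => //; first by apply: ltn_trans ltdn.
  by move=> i lei; rewrite /path_rel eqxx; lia.
have wR : walk (adj G) d w.
  move=> i lti; apply/adj_graph_of; rewrite !wE //; last exact: ltnW.
  by split; [lia | left; rewrite /path_rel eqxx].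
have nw : w 0 <> w d by move/(congr1 val); rewrite /= !wE; lia.
have fin := anchored_adj K_gt1 sG an wR nw.
set M := 2 ^ _ in fin.
apply: (@running_time_gt _ K G t.+1 (M + t.+1)); first exact: leq_addl.
move=> E.
have : adj (bootstrap (cycle_graph K.+1) G t.+1) (w 0) (w d).
  rewrite E; apply: adj_boot_leq (leq_addr _ _) _.
  by apply: fin; rewrite (negbTE evK).
case/(first_step_reach K_gt1 sG) => N [leN dvN [u [uR u0 uN]]].
have [|x [y [a [b [EN EP]]]]] := @count_steps K N (fun j => u j).
  by move=> j ltj; apply/path_first_step/uR.
apply: (even_count K_gt1 evK leKt Ed leN dvN EN).
by move: EP; rewrite /= u0 uN !wE.
Qed.

End EvenLower.

(* The extremal graph for even k: m, m + 1, m + 2 is the triangle and m + 3 the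
   twin of 0. *)
Definition lasso_rel (m x y : nat) : bool :=
  [|| (y == x.+1) && (y <= m + 2), (x == m) && (y == m + 2) | (x == 1) && (y == m + 3)].

(* The two positions of a vertex on the closed walk of length 2m + 3 that runs
   from 0 around the triangle and back to the twin of 0, one for each parity. *)
Definition lasso_pos (m : nat) (e : bool) (u : nat) : nat :=
  let v := if u == m + 3 then 0 else u in if odd v == e then v else m.*2 + 3 - v.

Section LassoRel.

Variable m : nat.
Hypothesis m_gt2 : 2 < m.

Let edge x y := lasso_rel m x y || lasso_rel m y x.
Local Notation pos := (lasso_pos m).

(** As in the bipartite double cover, an edge flips the parity [e] and moves the position by one. *)
Lemma lasso_step e x y : edge x y ->
  pos (~~ e) y = pos e x + 1 \/ pos e x = pos (~~ e) y + 1.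
Proof.
rewrite /edge /lasso_rel /lasso_pos => h.
move: h; case: (x =P m + 3) => hx; case: (y =P m + 3) => hy h; case: ifP => p1; case: ifP => p2; lia.
Qed.

Lemma lasso_le x y : edge x y -> x <= m + 3.
Proof. by rewrite /edge /lasso_rel; lia. Qed.

(* Two vertices at the same position are twins, and a path that passes through
   both of them cannot be continued. *)
Lemma lasso_noturn e a b c d : edge a b -> edge b c -> edge c d ->
  a <> c -> b <> d -> a <> d -> pos e a <> pos e c.
Proof.
move=> ab bc cd ac bd ad E.
have la := lasso_le ab.
have lc := lasso_le cd.
have : (a = 0 /\ c = m + 3 \/ a = m + 3 /\ c = 0) \/
       (a = m + 1 /\ c = m + 2 \/ a = m + 2 /\ c = m + 1).
  clear -m_gt2 la lc ac E; move: E; rewrite /lasso_pos.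
  case: (a =P m + 3) => ha; case: (c =P m + 3) => hc; case: ifP => p1; try (case: ifP => p2); lia.
move: ab bc cd; rewrite /edge /lasso_rel; lia.
Qed.

Lemma lasso_mid e u : u <= m + 3 -> pos e u = m \/ pos e u = m + 3 -> u = m.
Proof. by rewrite /lasso_pos; case: (u =P m + 3) => hu; case: ifP => p1; lia. Qed.

End LassoRel.

(* P is the landing point on the triangle; x, y, a, b count the steps K, -K, 1
   and -1 on each side of it. *)
Lemma odd_count K V m P x1 y1 a1 b1 x2 y2 a2 b2 : 2 < K -> K <= V ->
  m.*2 + 3 = K * (V + 3 - K) -> P = m + 1 \/ P = m + 2 ->
  x1 + y1 + a1 + b1 + (x2 + y2 + a2 + b2) <= V ->
  P + K * y1 + b1 = K * x1 + a1 ->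
  m.*2 + 3 + K * y2 + b2 = P + K * x2 + a2 -> False.
Proof.
move=> K_gt2 leKV El hP leV E1 E2.
have EW : K * (V + 3 - K) + K * K = K * V + 3 * K.
  by rewrite -mulnDr subnK ?mulnDr ?[K * 3]mulnC //; apply: leq_trans leKV (leq_addr _ _).
have EKV : K * x1 + K * y1 + K * a1 + K * b1 + (K * x2 + K * y2 + K * a2 + K * b2) <= K * V.
  by rewrite -!mulnDr leq_mul2l leV orbT.
have EKK : (K - 1) * (K - 1) + 2 * K = K * K + 1.
  by case: K K_gt2 {leKV El leV E1 E2 EW EKV} => // K' _; rewrite subn1 /=; nia.
have leaK : a1 + a2 <= K - 2.
  rewrite leqNgt; apply/negP=> lt.
  have h1 : (K - 1) * (K - 1) <= (K - 1) * (a1 + a2) by rewrite leq_mul2l; lia.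
  have h2 : (K - 1) * (a1 + a2) + (a1 + a2) = K * (a1 + a2).
    by rewrite -mulSnr; congr (_ * _); lia.
  by rewrite [K * (_ + _)]mulnDr in h2; lia.
have leab : a1 + a2 + (b1 + b2) <= K - 3.
  rewrite leqNgt; apply/negP=> lt.
  have h1 : K * (K - 2) <= K * (a1 + a2 + (b1 + b2)) by rewrite leq_mul2l; lia.
  have h2 : K * (K - 2) + 2 * K = K * K.
    by rewrite [2 * K]mulnC -mulnDr; congr (_ * _); lia.
  by rewrite !mulnDr in h1; lia.
(* [K] divides [m.*2 + 3], so the few unit steps balance. *)
have Eab : b1 + b2 = a1 + a2.
  by apply: (@modn_cancel K (V + 3 - K + (y1 + y2)) (x1 + x2)); rewrite ?mulnDr; lia.
(* [P.*2] differs by one from the multiple [m.*2 + 3] of [K], so [a1.*2] and [b1.*2], both below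
   [K], would differ by one. *)
case: hP => EP.
  have : 2 * b1 = 2 * a1 + 1; last lia.
  by apply: (@modn_cancel K (V + 3 - K + (y1 + y1)) (x1 + x1)); rewrite ?mulnDr; lia.
have : 2 * b1 + 1 = 2 * a1; last lia.
by apply: (@modn_cancel K (V + 3 - K + (y1 + y1)) (x1 + x1)); rewrite ?mulnDr; lia.
Qed.

Section OddLower.

Variables (n K t m : nat).
Hypothesis K_gt2 : 2 < K.
Hypothesis oddK : odd K.
Hypothesis leKt : K <= K ^ t.
Hypothesis Em : m.*2 + 3 = K * (K ^ t + 3 - K).
Hypothesis ltmn : m + 4 <= n.
Let K_gt1 : 1 < K := ltnW K_gt2.

Let G := graph_of n (lasso_rel m).
Let sG : simple_graph G := simple_graph_of n (lasso_rel m).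
Local Notation pos := (lasso_pos m).

Lemma lasso_size : K <= m.+1 /\ 2 < m.
Proof.
have h : 3 * K <= m.*2 + 3 by rewrite Em mulnC leq_mul2l; lia.
by lia.
Qed.

Lemma lasso_adj (a b : 'I_n) : adj G a b -> lasso_rel m a b || lasso_rel m b a.
Proof. by move/adj_graph_of=> [_ h]; apply/orP. Qed.

(** Positions along a path with [K] edges do not turn, hence change by [K] in all. A path crossing
    the triangle completely would meet the positions [m] and [m + 3], which belong to the same
    vertex [m]. *)
Lemma lasso_first_step e (x y : 'I_n) : adj (bootstrap (cycle_graph K.+1) G 1) x y ->
  [\/ pos (~~ e) y = pos e x + K, pos e x = pos (~~ e) y + K,
      pos (~~ e) y = pos e x + 1 | pos e x = pos (~~ e) y + 1] /\
  ~ (pos e x <= m /\ m + 3 <= pos (~~ e) y).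
Proof.
have [_ m_gt2] := lasso_size.
case/(adj_bootS K_gt1 _ _ _ sG) => [/lasso_adj/(lasso_step m_gt2 e) h|[w [<- <- wI wR]]].
  by split; [case: h; [constructor 3 | constructor 4] | lia].
pose P j := pos (e (+) odd j) (w j).
have E0 : pos e (w 0) = P 0 by rewrite /P addbF.
have EK : pos (~~ e) (w K) = P K by rewrite /P oddK addbT.
have PS j : j < K -> P j.+1 = P j + 1 \/ P j = P j.+1 + 1.
  by move=> ltj; rewrite /P /= addbN; apply: lasso_step => //; apply: lasso_adj; apply: wR.
have ne i j : i < j <= K -> w i <> w j :> nat by move=> hij /val_inj/wI; lia.
have wS j : j < K -> lasso_rel m (w j) (w j.+1) || lasso_rel m (w j.+1) (w j).
  by move=> ltj; apply: lasso_adj; apply: wR.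
have Pturn j : j.+2 <= K -> P j.+2 <> P j.
  move=> lej; rewrite /P /= negbK.
  case: (ltnP j.+2 K) => hj.
    apply: nesym; apply: (lasso_noturn m_gt2 (wS j _) (wS j.+1 _) (wS j.+2 _)); try lia.
    - by apply: ne; lia.
    - by apply: ne; lia.
    - by apply: ne; lia.
  (* A turn at the end of the path has no continuation ahead and is excluded on the reversed
     path. *)
  case: j lej hj => [|j] lej hj; first by lia.
  have wS' i : i < K -> lasso_rel m (w i.+1) (w i) || lasso_rel m (w i) (w i.+1).
    by rewrite orbC; apply: wS.
  apply: (lasso_noturn m_gt2 (wS' j.+2 _) (wS' j.+1 _) (wS' j _)); try lia.
  - by apply: nesym; apply: ne; lia.
  - by apply: nesym; apply: ne; lia.
  - by apply: nesym; apply: ne; lia.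
rewrite E0 EK; case: (monotone_steps K_gt1 PS Pturn) => h.
  split; first by constructor 1; apply: h.
  case=> hP hK; rewrite h // in hK.
  pose i := m - P 0.
  have lei : i + 3 <= K by rewrite /i; lia.
  have wm j : j <= K -> P j = m \/ P j = m + 3 -> w j = m :> nat.
    move=> lej; apply: lasso_mid => //.
    case: j lej => [|j] lej; first by apply: lasso_le (wS 0 _); lia.
    by have := wS j lej; rewrite orbC => /(lasso_le m_gt2).
  have e1 : w i = m :> nat by apply: wm; [lia | left; rewrite h; rewrite /i; lia].
  have e2 : w (i + 3) = m :> nat by apply: wm; [lia | right; rewrite h; rewrite /i; lia].
  by apply: (ne i (i + 3)); [lia | rewrite e1 e2].
have hK := h K (leqnn K).
by split; [constructor 2 | lia].
Qed.

(** The twins 0 and [m + 3] are joined by an odd walk and become adjacent in the end. If they were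
    so after [t.+1] steps, at most [K ^ t] first-step edges would lead from position 0 to
    [m.*2 + 3], contrary to [odd_count]. *)
Lemma odd_lower : t.+1 < running_time (cycle_graph K.+1) G.
Proof.
have [leKm m_gt2] := lasso_size.
have n_gt0 : 0 < n by apply: leq_trans ltmn; rewrite addn4.
pose V (i : nat) : 'I_n := insubd (Ordinal n_gt0) i.
have VE i : i <= m + 3 -> V i = i :> nat.
  by move=> lei; rewrite /V val_insubd (leq_trans _ ltmn) //; lia.
(* Up to [m + 2], across the triangle to [m], down to 1, and on to the twin of 0. *)
pose f i := if i == m.*2 + 3 then m + 3 else if i <= m + 2 then i else m.*2 + 3 - i.
have lef i : i <= m.*2 + 3 -> f i <= m + 3.
  by rewrite /f; case: eqP => h; [lia | case: (leqP i (m + 2)); lia].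
have f0 : f 0 = 0 by rewrite /f addn3.
pose w i := V (f i).
have wE i : i <= m.*2 + 3 -> w i = f i :> nat by move=> h; apply: VE; apply: lef.
have an : anchored K G (w 0).
  apply: anchored_graph_of => //; first by lia.
    by move=> i lei; rewrite /lasso_rel eqxx; lia.
  by rewrite wE.
have wR : walk (adj G) (m.*2 + 3) w.
  move=> i lti; apply/adj_graph_of; rewrite !wE //; last exact: ltnW.
  rewrite /f /lasso_rel; case: (i =P m.*2 + 3) => h1; first by lia.
  case: (i.+1 =P m.*2 + 3) => h2; case: (leqP i (m + 2)) => h3;
    case: (leqP i.+1 (m + 2)) => h4; lia.
have fl : f (m.*2 + 3) = m + 3 by rewrite /f eqxx.
have nw : w 0 <> w (m.*2 + 3).
  by move/(congr1 val); rewrite /= !wE // f0 fl; lia.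
have ol : odd (m.*2 + 3) by rewrite oddD odd_double.
have fin := anchored_adj K_gt1 sG an wR nw (fun _ => ol).
set M := 2 ^ _ in fin.
apply: (@running_time_gt _ K G t.+1 (M + t.+1)); first exact: leq_addl.
move=> E.
have : adj (bootstrap (cycle_graph K.+1) G t.+1) (w 0) (w (m.*2 + 3)).
  by rewrite E; apply: adj_boot_leq (leq_addr _ _) fin.
case/(first_step_reach K_gt1 sG) => N [leN dvN [u [uR u0 uN]]].
have oN : odd N.
  have evV : ~~ odd (K ^ t - N).
    by case/dvdnP: dvN => q ->; rewrite oddM oddB ?oddK ?andbF //; lia.
  by move: evV; rewrite oddB // oddX oddK orbT /= negbK.
pose P j := pos (odd j) (u j).
have P0 : P 0 = 0.
  by rewrite /P u0 wE // f0 /lasso_pos addn3.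
have PN : P N = m.*2 + 3.
  by rewrite /P uN wE // fl /lasso_pos eqxx oN /= subn0.
have PS j : j < N -> [\/ P j.+1 = P j + K, P j = P j.+1 + K, P j.+1 = P j + 1 | P j = P j.+1 + 1] /\
    ~ (P j <= m /\ m + 3 <= P j.+1).
  by move=> ltj; apply: lasso_first_step; apply: uR.
(* This step leaves the range up to [m] and cannot reach [m + 3], so it lands on [m + 1] or
   [m + 2]. *)
have [i ltiN [hi1 hi2]] : exists2 i, i < N & P i <= m /\ m < P i.+1.
  have hN : m < P N by rewrite PN; lia.
  clear -hN P0; elim: (N) hN => [|N' IH] hN; first by rewrite P0 in hN.
  case: (ltnP m (P N')) => h; last by exists N'.
  by have [i lti hi] := IH h; exists i => //; apply: ltnW.
have [_ ncross] := PS i ltiN.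
have [j0|x1 [y1 [a1 [b1 [EN1 E1]]]]] := @count_steps K i.+1 P.
  by move=> ltj; case: (PS j0) => //; apply: leq_trans ltj ltiN.
have [j0|x2 [y2 [a2 [b2 [EN2 E2]]]]] := @count_steps K (N - i.+1) (fun j => P (i.+1 + j)).
  by move=> ltj; rewrite addnS; case: (PS (i.+1 + j0)) => //; lia.
rewrite P0 add0n in E1; rewrite addn0 subnKC // PN in E2.
apply: (odd_count K_gt2 leKt Em _ _ E1 E2); last by rewrite EN1 EN2 subnKC.
by lia.
Qed.

End OddLower.

(** * The running time *)

Lemma max_running_time_eq (U : finType) (H : {set {set U}}) n t :
  (forall G : {set {set 'I_n}}, simple_graph G -> running_time H G <= t) ->
  (exists2 G : {set {set 'I_n}}, simple_graph G & t <= running_time H G) ->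
  max_running_time H n = t.
Proof.
move=> up [G sG low]; apply/eqP; rewrite eqn_leq; apply/andP; split.
  by apply/bigmax_leqP => G' sG'; apply: up.
exact: leq_trans low (leq_bigmax_cond _ sG).
Qed.

Lemma up_log_succ K X : 1 < K -> 1 < X ->
  exists2 t, up_log K X = t.+1 & K ^ t < X <= K ^ t.+1.
Proof.
move=> K_gt1 X_gt1; exists (up_log K X).-1.
  by rewrite prednK // up_log_gt0 K_gt1.
have h := up_log_bounds K_gt1 X_gt1.
by rewrite prednK ?up_log_gt0 ?K_gt1 //; move: h => /andP[-> ->].
Qed.

(* up_log b m is the ceiling of the base-b logarithm of m. The truncated
   subtractions below are exact as soon as n >= 3. *)
Theorem theorem1p2 (k : nat) (hk : 3 <= k) :
  exists N : nat, forall n : nat, N <= n ->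
    max_running_time (cycle_graph k) n =
      if odd k then up_log (k - 1) (n + k ^ 2 - 4 * k + 2)
      else up_log (k - 1) (2 * n + k ^ 2 - 5 * k).
Proof.
case: k hk => // K hK; have K_gt1 : 1 < K := hK.
have K_gt0 : 0 < K := ltnW K_gt1.
(* Large [n] pushes the exponent to at least [A], past the bounded times needed by the upper
   bounds. *)
have [A [A1 A2 A3]] : exists A, [/\ path_time K + 2 <= A, 2 ^ K.+1 <= A & 2 < A].
  by exists (path_time K + 2 ^ K.+1 + 3); move: (path_time K) (2 ^ K.+1) => x y; split; lia.
exists (K ^ A + 5 * K + 4) => n leNn; rewrite subn1 [K.+1.-1]/=.
have leK2 : 2 * K <= K * K by rewrite leq_mul2r K_gt1 orbT.
have Ek2 : K.+1 ^ 2 = K * K + 2 * K + 1 by rewrite expnS expn1; lia.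
have PA : 0 < K ^ A by rewrite expn_gt0 K_gt0.
rewrite [odd K.+1]/=; case: ifPn => [oK|]; last rewrite negbK => oK; last first.
  have -> : 2 * n + K.+1 ^ 2 - 5 * K.+1 = 2 * n + K * K - 3 * K - 4.
    by rewrite Ek2; lia.
  have K_gt2 : 2 < K by rewrite ltn_neqAle K_gt1 andbT; apply: contraTneq oK => <-.
  set X := 2 * n + _ - _ - _.
  have X_gt : K ^ A < X by rewrite /X; lia.
  have X_gt1 : 1 < X by lia.
  have [t' -> /andP[ltX leX]] := up_log_succ K_gt1 X_gt1.
  have ltA : A < t'.+1 by rewrite -(ltn_exp2l _ _ K_gt1); apply: leq_trans leX.
  have [t Et leAt] : exists2 t, t' = t.+1 & A <= t.+2 by exists t'.-1; lia.
  subst t'.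
  have lept : path_time K <= t by lia.
  have leKt : K <= K ^ t.
    by rewrite -{1}[K]expn1 leq_exp2l //; lia.
  apply: max_running_time_eq => [G sG|].
    apply: running_time_leq => //; apply: boot_stabilised => //.
      exact: leq_trans A2 leAt.
    move=> g v an vR nv og; apply: odd_upper => //; last exact: og.
    by rewrite card_ord; rewrite /X in leX; lia.
  have EKt : K * (K ^ t + 3 - K) + K * K = K ^ t.+1 + 3 * K.
    by rewrite -mulnDr subnK ?mulnDr ?[K * 3]mulnC ?expnS //; lia.
  (* The walk between the twins has deficit [K * (K - 3)] from [K ^ t.+1], the largest even number
     below [(K - 1) * (K - 2)]. *)
  pose m := (K * (K ^ t + 3 - K) - 3)./2.
  have ge3 : 3 * K <= K * (K ^ t + 3 - K) by rewrite mulnC leq_mul2l; lia.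
  have oW : odd (K * (K ^ t + 3 - K)).
    by rewrite oddM oK oddB ?oddD ?oddX ?oK ?orbT //; lia.
  have Em : m.*2 + 3 = K * (K ^ t + 3 - K).
    rewrite /m even_halfK ?subnK //; first by lia.
    by rewrite oddB ?oW //; lia.
  exists (graph_of n (lasso_rel m)); first exact: simple_graph_of.
  by apply: (@odd_lower n K t m K_gt2 oK leKt Em); rewrite /X in ltX; lia.
have -> : n + K.+1 ^ 2 - 4 * K.+1 + 2 = n + K * K - 2 * K - 1.
  by rewrite Ek2; lia.
set X := n + _ - _ - _.
have X_gt : K ^ A < X by rewrite /X; lia.
have X_gt1 : 1 < X by lia.
have [t' -> /andP[ltX leX]] := up_log_succ K_gt1 X_gt1.
have ltA : A < t'.+1 by rewrite -(ltn_exp2l _ _ K_gt1); apply: leq_trans leX.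
have [t Et leAt] : exists2 t, t' = t.+1 & A <= t.+2 by exists t'.-1; lia.
subst t'.
have leKt : K <= K ^ t.
  by rewrite -{1}[K]expn1 leq_exp2l //; lia.
apply: max_running_time_eq => [G sG|].
  apply: running_time_leq => //; apply: boot_stabilised => //.
    exact: leq_trans A2 leAt.
  move=> g v an vR nv _; apply: even_upper => //.
    by lia.
  by rewrite card_ord; rewrite /X in leX; lia.
have EKt : K * (K ^ t + 2 - K) + K * K = K ^ t.+1 + 2 * K.
  by rewrite -mulnDr subnK ?mulnDr ?[K * 2]mulnC ?expnS //; lia.
exists (graph_of n (path_rel (K * (K ^ t + 2 - K) + 1))); first exact: simple_graph_of.
by apply: even_lower => //; rewrite /X in ltX; lia.
Qed.
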